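(* Let $\mu,\nu\in\mathcal{T}^0$ be two inner nodes. Then $\mu\sim\nu$ if and only if the following three conditions hold: (a) The valuations $\mu$, $\nu$ admit a common key polynomial of minimal degree (that is, there is $\phi\in \mathrm{KP}(\mu)\cap \mathrm{KP}(\nu)$ which has minimal degree in both $\mathrm{KP}(\mu)$ and $\mathrm{KP}(\nu)$). (b) For all $a\in K[x]$ such that $\deg(a)<\deg(\mu)$, we have $\mu(a)=\nu(a)$. (c) $\mathrm{sv}(\mu)\sim_{\mathrm{sme}} \mathrm{sv}(\nu)$. In this case, we have $\mathrm{KP}(\mu)=\mathrm{KP}(\nu)$.
   Context: Valuations. For an ordered abelian group $\Lambda$ write $\Lambda\infty=\Lambda\cup\{\infty\}$. A valuation on a commutative ring $A$ is a map $\mu\colon A\to\Lambda\infty$ with $\mu(1)=0$, $\mu(0)=\infty$, $\mu(ab)=\mu(a)+\mu(b)$, $\mu(a+b)\ge\min\{\mu(a),\mu(b)\}$. Its support is the prime ideal $\mathfrak p=\mu^{-1}(\infty)$; its value group $\Gamma_\mu$ is the subgroup of $\Lambda$ generated by $\mu(A\setminus\mathfrak p)$. Two valuations $\mu,\nu$ on $A$ are equivalent, $\mu\sim\nu$, if there is an isomorphism of ordered groups $\iota\colon\Gamma_\mu\to\Gamma_\nu$ with $\nu=\iota\circ\mu$ (with $\iota(\infty)=\infty$). Base field and the universal group. $(K,v)$ is a valued field with value group $\Gamma=v(K^* )$ and $\Gamma_{\mathbb Q}=\Gamma\otimes\mathbb Q$. Let $I$ be a totally ordered set indexing the nonzero principal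 convex subgroups $H_i$ of $\Gamma_{\mathbb Q}$ (those generated, as convex subgroups, by one element), with $i<j\iff H_i\supsetneq H_j$. Let $H_i^*$ be the maximal proper convex subgroup of $H_i$ and $Q_i=H_i/H_i^*$. The Hahn products $\mathbf H(\Gamma_{\mathbb Q})\subset\prod_{i\in I}Q_i$ and $\mathbb R^I_{\mathrm{lex}}\subset\mathbb R^I$ consist of the elements with well-ordered support, with the lexicographical order. Fix a Hahn $\mathbb Q$-linear order embedding $\Gamma_{\mathbb Q}\hookrightarrow\mathbf H(\Gamma_{\mathbb Q})$ inducing an isomorphism of skeletons, and order embeddings $Q_i\hookrightarrow\mathbb R$ sending a chosen positive element to $1$; through the composition $\Gamma\hookrightarrow\Gamma_{\mathbb Q}\hookrightarrow\mathbf H(\Gamma_{\mathbb Q})\hookrightarrow\mathbb R^I_{\mathrm{lex}}$ we regard $\Gamma\subset\Gamma_{\mathbb Q}\subset\mathbb R^I_{\mathrm{lex}}$ as subgroups, so $v$ takes values in $\mathbb R^I_{\mathrm{lex}}$. Let $\mathrm{Init}(I)$ be the set of initial segments of $I$ (including $\emptyset$ and $I$). For $S\in\mathrm{Init}(I)$ let $i_S$ be a formal symbol and $I_S=S+\{i_S\}+(I\setminus S)$ (ordered sum). Let $\mathbb I=I\cup\{i_S\mid S\in\mathrm{Init}(I)\}$ with the total order such that each inclusion $I_S\hookrightarrow\mathbb I$ preserves the order, and $i_S<i_T$ iff $S\subsetneq T$. Let $\mathbb R^{\mathbb I}_{\mathrm{lex}}$ and $\mathbb R^{I_S}_{\mathrm{lex}}$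 be the analogous Hahn products; extension by zero gives embeddings $\mathbb R^I_{\mathrm{lex}}\subset\mathbb R^{I_S}_{\mathrm{lex}}\subset\mathbb R^{\mathbb I}_{\mathrm{lex}}$. Put $\mathbb R_{\mathrm{sme}}=\bigcup_{S\in\mathrm{Init}(I)}\mathbb R^{I_S}_{\mathrm{lex}}\subset\mathbb R^{\mathbb I}_{\mathrm{lex}}$. For $\beta,\gamma\in\mathbb R_{\mathrm{sme}}$, write $\beta\sim_{\mathrm{sme}}\gamma$ if there is an isomorphism of ordered groups $\langle\Gamma,\beta\rangle\to\langle\Gamma,\gamma\rangle$ which is the identity on $\Gamma$ and sends $\beta$ to $\gamma$. Trees. Let $\Lambda=\mathbb R^{\mathbb I}_{\mathrm{lex}}$ and let $\mathcal T$ be the set of all valuations $\mu\colon K[x]\to\Lambda\infty$ with $\mu_{|K}=v$, partially ordered by $\mu\le\nu\iff\mu(f)\le\nu(f)$ for all $f\in K[x]$. Its maximal elements are the leaves; the other elements are the inner nodes. Let $\mathcal T^0=\{\rho\in\mathcal T\mid\Gamma_\rho\subset\mathbb R^{I_S}_{\mathrm{lex}}\text{ for some }S\in\mathrm{Init}(I)\}$; ''inner node'' of $\mathcal{T}^0$ means an element of $\mathcal{T}^0$ that is an inner node. Key polynomials. For $\mu\in\mathcal T$ with support $\mathfrak p$ and $\alpha\in\Gamma_\mu$ let $\mathcal P_\alpha=\{g\mid\mu(g)\ge\alpha\}$, $\mathcal P_\alpha^+=\{g\mid\mu(g)>\alpha\}$; the graded algebra is $\mathcal G_\mu=\bigoplus_{\alpha\in\Gamma_\mu}\mathcal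 P_\alpha/\mathcal P_\alpha^+$. The initial term is $\mathrm{in}_\mu g=g+\mathcal P^+_{\mu(g)}$ for $g\notin\mathfrak p$, and $\mathrm{in}_\mu g=0$ for $g\in\mathfrak p$. Write $h\mid_\mu g$ if $\mathrm{in}_\mu h$ divides $\mathrm{in}_\mu g$ in $\mathcal G_\mu$. A polynomial $g$ is $\mu$-irreducible if $(\mathrm{in}_\mu g)\mathcal G_\mu$ is a nonzero prime ideal, and $\mu$-minimal if $g\nmid_\mu f$ for all nonzero $f$ with $\deg f<\deg g$. A key polynomial for $\mu$ is a monic polynomial that is both $\mu$-minimal and $\mu$-irreducible; $\mathrm{KP}(\mu)$ is the set of them. A node $\mu$ is inner iff $\mathrm{KP}(\mu)\ne\emptyset$. For an inner node, $\deg(\mu)=\deg(\phi)$ and $\mathrm{sv}(\mu)=\mu(\phi)$ for any $\phi\in\mathrm{KP}(\mu)$ of minimal degree (these do not depend on $\phi$). *)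

(* Defs.v *)
From HB Require Import structures.
From mathcomp Require Import all_boot all_order all_algebra.
From mathcomp Require Import boolp classical_sets reals.

Set Implicit Arguments.
Unset Strict Implicit.
Unset Printing Implicit Defensive.

Import Order.TTheory GRing.Theory Num.Theory.

Local Open Scope classical_set_scope.
Local Open Scope ring_scope.

(* Totally ordered abelian groups, packed by hand: an HB structure combining
   [Order.Total ring_display] with [GRing.Zmodule] lacks the joins that
   [Num.RealDomain] would require. *)
Record oagType := OAG {
  oag_base : porderZmodType;
  oag_base_total : total (<=%O : rel oag_base);
  oag_base_leD2l : forall z x y : oag_base, x <= y -> z + x <= z + y
}.

Definition oag_sort (G : oagType) : Type := oag_base G.
Coercion oag_sort : oagType >-> Sortclass.

HB.instance Definition _ (G : oagType) :=
  Num.POrderedZmodule.copy (oag_sort G) (oag_base G).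
HB.instance Definition _ (G : oagType) :=
  Order.POrder_isTotal.Build ring_display (oag_sort G) (@oag_base_total G).

Lemma oag_leD2l (G : oagType) (z x y : G) : x <= y -> z + x <= z + y.
Proof. exact: oag_base_leD2l. Qed.

Section RealOAG.
Variable R : realType.
Fact real_leD2l (z x y : R) : x <= y -> z + x <= z + y.
Proof. by rewrite lerD2l. Qed.
Definition real_oag : oagType := OAG (@le_total _ R) real_leD2l.
End RealOAG.

Section OAGTheory.
Variable G : oagType.
Implicit Types x y z : G.

Lemma oag_leD2lE z x y : (z + x <= z + y) = (x <= y).
Proof.
apply/idP/idP; last exact: oag_leD2l.
by move/(oag_leD2l (- z)); rewrite !addKr.
Qed.

Lemma oag_ltD2lE z x y : (z + x < z + y) = (x < y).
Proof. by rewrite !ltNge oag_leD2lE. Qed.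

Lemma oag_ltD2rE z x y : (x + z < y + z) = (x < y).
Proof. by rewrite ![_ + z]addrC oag_ltD2lE. Qed.

Definition is_subgroup (H : set G) : Prop :=
  H 0 /\ forall x y, H x -> H y -> H (x - y).

Definition subgroup_gen (X : set G) : set G := smallest is_subgroup X.

Definition is_convex_subgroup (H : set G) : Prop :=
  is_subgroup H /\
  forall x y z, H x -> H z -> x <= y -> y <= z -> H y.

Definition convex_gen (X : set G) : set G := smallest is_convex_subgroup X.

Definition nonzero_principal (H : set G) : Prop :=
  exists a : G, a != 0 /\ H = convex_gen [set a].

(* The convex subgroups form a chain, and when [H] is nonzero and principal,
   none of its proper convex subgroups contains a generator; so this union is
   the maximal proper convex subgroup of [H]. *)
Definition convex_star (H : set G) : set G :=
  \bigcup_(C in [set C | is_convex_subgroup C /\ C `<` H]) C.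

End OAGTheory.

(* [f] restricts to an isomorphism of ordered groups from the subgroup [A] onto
   the subgroup [B]; its values outside [A] are irrelevant. *)
Definition is_oag_iso (G G' : oagType) (A : set G) (B : set G') (f : G -> G')
    : Prop :=
  [/\ f @` A = B,
      forall x y, A x -> A y -> f (x + y) = f x + f y
    & forall x y, A x -> A y -> (f x <= f y) = (x <= y)].

(* [j] identifies [GQ] with [G (x) QQ]: a divisible (ordered, hence
   torsion-free) group in which every element has a positive multiple in [G]. *)
Definition is_rational_hull (G GQ : oagType) (j : {additive G -> GQ}) : Prop :=
  [/\ {mono j : x y / x <= y},
      forall (n : nat) (y : GQ), (0 < n)%N -> exists z, z *+ n = y
    & forall y : GQ, exists (n : nat) (x : G), (0 < n)%N /\ y *+ n = j x].

(* [p], restricted to [H], is a model of the quotient map of ordered groups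
   [H -> H / N], for [N] a convex subgroup of [H]. *)
Definition is_quotient_map (G Q : oagType) (H N : set G) (p : G -> Q) : Prop :=
  [/\ forall x y, H x -> H y -> p (x + y) = p x + p y,
      forall x y, H x -> H y -> x <= y -> p x <= p y,
      forall q, exists2 x, H x & p x = q
    & forall x, H x -> (p x = 0 <-> N x)].

(* The decreasing family of all nonzero principal convex subgroups. *)
Definition indexes_principal (G : oagType) d (I : orderType d) (H : I -> set G)
    : Prop :=
  [/\ forall i, nonzero_principal (H i),
      forall C, nonzero_principal C -> exists i, H i = C
    & forall i j, ((i < j)%O : Prop) <-> H j `<` H i].

(* An order embedding [f : G -> G'] induces maps
     <a> |-> <f a>   on nonzero principal convex subgroups, and
     <a> / <a>^* -> <f a> / <f a>^*   on the corresponding quotients;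
   the four clauses say that these maps are injective and surjective. *)
Definition induces_skeleton_iso (G G' : oagType) (f : G -> G') : Prop :=
  [/\ forall a b : G, a != 0 -> b != 0 ->
        convex_gen [set f a] = convex_gen [set f b] ->
        convex_gen [set a] = convex_gen [set b],
      forall b : G', b != 0 ->
        exists2 a, a != 0 & convex_gen [set f a] = convex_gen [set b],
      forall a : G, a != 0 ->
        forall x, convex_gen [set a] x ->
          convex_star (convex_gen [set f a]) (f x) ->
          convex_star (convex_gen [set a]) x
    & forall a : G, a != 0 ->
        forall y, convex_gen [set f a] y ->
          exists2 x, convex_gen [set a] x &
                     convex_star (convex_gen [set f a]) (y - f x)].

Definition well_ordered d (I : orderType d) (A : set I) : Prop :=
  forall B : set I, B `<=` A -> B !=set0 ->
    exists2 m, B m & forall b, B b -> (m <= b)%O.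

Lemma well_ordered_sub d (I : orderType d) (A B : set I) :
  well_ordered B -> A `<=` B -> well_ordered A.
Proof. by move=> wB AB C CA; apply: wB => x /CA /AB. Qed.

Lemma well_orderedU d (I : orderType d) (A B : set I) :
  well_ordered A -> well_ordered B -> well_ordered (A `|` B).
Proof.
move=> wA wB C CAB [c Cc].
have [[a [Ca Aa]]|nA] := pselect (exists a, C a /\ A a); last first.
  apply: wB; last by exists c.
  by move=> x Cx; have [Ax|//] := CAB _ Cx; case: nA; exists x.
have [[b [Cb Bb]]|nB] := pselect (exists b, C b /\ B b); last first.
  apply: wA; last by exists c.
  by move=> x Cx; have [//|Bx] := CAB _ Cx; case: nB; exists x.
have [m [Cm Am] mP] : exists2 m, (C `&` A) m &
    forall x, (C `&` A) x -> (m <= x)%O.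
  by apply: wA; [move=> x []|exists a].
have [n [Cn Bn] nP] : exists2 m, (C `&` B) m &
    forall x, (C `&` B) x -> (m <= x)%O.
  by apply: wB; [move=> x []|exists b].
exists (Order.min m n); first by rewrite /Order.min; case: ifP.
move=> x Cx; rewrite ge_min; have [Ax|Bx] := CAB _ Cx.
- by rewrite mP.
- by rewrite nP ?orbT.
Qed.

Record hahn d (I : orderType d) (Q : I -> oagType) := Hahn {
  hahn_val :> forall i, Q i;
  hahn_supp_wo : well_ordered [set i | hahn_val i != 0]
}.
Arguments hahn_supp_wo {d I Q} _.

Section HahnGroup.
Context d (I : orderType d) (Q : I -> oagType).
Implicit Types x y z : hahn Q.

HB.instance Definition _ := gen_eqMixin (hahn Q).
HB.instance Definition _ := gen_choiceMixin (hahn Q).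

Lemma hahnP x y : (forall i, x i = y i) -> x = y.
Proof.
move=> exy; have {}exy := functional_extensionality_dep exy.
case: x y exy => [x px] [y py] /= exy; subst y.
by rewrite (Prop_irrelevance px py).
Qed.

Fact hahn_zero_wo : well_ordered [set i : I | (0 : Q i) != 0].
Proof. by move=> B BA [x /BA]; rewrite /= eqxx. Qed.
Definition hahn_zero : hahn Q := Hahn hahn_zero_wo.

Fact hahn_opp_wo x : well_ordered [set i | - x i != 0].
Proof.
by apply: (well_ordered_sub (hahn_supp_wo x)) => i /=; rewrite oppr_eq0.
Qed.
Definition hahn_opp x : hahn Q := Hahn (@hahn_opp_wo x).

Fact hahn_add_wo x y : well_ordered [set i | x i + y i != 0].
Proof.
apply: (well_ordered_sub (well_orderedU (hahn_supp_wo x) (hahn_supp_wo y))).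
move=> i /=; have [->|] := eqVneq (x i) 0; last by left.
by rewrite add0r; right.
Qed.
Definition hahn_add x y : hahn Q := Hahn (@hahn_add_wo x y).

Fact hahn_addA : associative hahn_add.
Proof. by move=> x y z; apply: hahnP => i /=; rewrite addrA. Qed.
Fact hahn_addC : commutative hahn_add.
Proof. by move=> x y; apply: hahnP => i /=; rewrite addrC. Qed.
Fact hahn_add0 : left_id hahn_zero hahn_add.
Proof. by move=> x; apply: hahnP => i /=; rewrite add0r. Qed.
Fact hahn_addN : left_inverse hahn_zero hahn_opp hahn_add.
Proof. by move=> x; apply: hahnP => i /=; rewrite addNr. Qed.

HB.instance Definition _ :=
  GRing.isZmodule.Build (hahn Q) hahn_addA hahn_addC hahn_add0 hahn_addN.

Lemma hahnDE x y i : (x + y) i = x i + y i. Proof. by []. Qed.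
Lemma hahnNE x i : (- x) i = - x i. Proof. by []. Qed.
Lemma hahn0E i : (0 : hahn Q) i = 0. Proof. by []. Qed.

Definition hahn_lt x y : bool :=
  `[< exists i, (forall j, (j < i)%O -> x j = y j) /\ x i < y i >].
Definition hahn_le x y : bool := (x == y) || hahn_lt x y.

Fact hahn_lt_irr : irreflexive hahn_lt.
Proof. by move=> x; apply/asboolP => -[i [_]]; rewrite ltxx. Qed.

Fact hahn_lt_trans : transitive hahn_lt.
Proof.
move=> y x z /asboolP[i [xy lxy]] /asboolP[j [yz lyz]]; apply/asboolP.
have [ij|ji|eij] := ltgtP i j.
- exists i; split=> [k ki|]; last by rewrite -(yz i).
  by rewrite xy // yz // (lt_trans ki).
- exists j; split=> [k kj|]; last by rewrite (xy j).
  by rewrite xy ?yz // (lt_trans kj).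
- subst j; exists i; split=> [k ki|]; first by rewrite xy // yz.
  exact: lt_trans lxy lyz.
Qed.

HB.instance Definition _ := Order.LtLe_isPOrder.Build ring_display (hahn Q)
  (fun x y => erefl) hahn_lt_irr hahn_lt_trans.

Lemma hahn_leE x y : (x <= y) = (x == y) || hahn_lt x y. Proof. by []. Qed.
Lemma hahn_ltE x y : (x < y) = hahn_lt x y. Proof. by []. Qed.

Fact hahn_le_total : total (<=%O : rel (hahn Q)).
Proof.
move=> x y; rewrite !hahn_leE (eq_sym y).
have [//|nxy] /= := eqVneq x y.
have [||m /= xym mP] := hahn_supp_wo (x - y) [set i | x i != y i].
- by move=> i /=; rewrite subr_eq0.
- apply: contrapT => no; case/eqP: nxy; apply: hahnP => i.
  by apply/eqP; apply/negPn/negP => ni; apply: no; exists i.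
- have xyE j : (j < m)%O -> x j = y j.
    move=> jm; apply/eqP/negPn/negP => /mP.
    by rewrite leNgt jm.
  move: xym; rewrite neq_lt => /orP[] lm; apply/orP; [left|right];
    by apply/asboolP; exists m; split=> // j jm; rewrite xyE.
Qed.

HB.instance Definition _ :=
  Order.POrder_isTotal.Build ring_display (hahn Q) hahn_le_total.

Fact hahn_leD2l z x y : x <= y -> z + x <= z + y.
Proof.
rewrite !hahn_leE => /orP[/eqP->|/asboolP[i [xy lxy]]]; first by rewrite eqxx.
apply/orP; right; apply/asboolP; exists i; split=> [j ji|].
  by rewrite !hahnDE xy.
by rewrite !hahnDE oag_ltD2lE.
Qed.

Definition hahn_oag : oagType := @OAG (hahn Q) hahn_le_total hahn_leD2l.

End HahnGroup.

Definition hahn_real (R : realType) d (I : orderType d) : Type :=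
  hahn (fun _ : I => real_oag R).
HB.instance Definition _ R d (I : orderType d) :=
  Num.POrderedZmodule.on (@hahn_real R d I).
HB.instance Definition _ R d (I : orderType d) :=
  Order.Total.on (@hahn_real R d I).

Section HahnMap.
Context d (I : orderType d) (Q : I -> oagType) (R : realType).
Variable t : forall i, {additive Q i -> R}.

Fact hahn_map_wo (x : hahn Q) : well_ordered [set i | t i (x i) != 0].
Proof.
apply: (well_ordered_sub (hahn_supp_wo x)) => i /=.
by apply: contra_neq => ->; rewrite raddf0.
Qed.

Definition hahn_map (x : hahn Q) : hahn_real R I :=
  @Hahn _ _ (fun _ : I => real_oag R) _ (@hahn_map_wo x).

End HahnMap.

Record init_seg d (I : orderType d) := InitSeg {
  init_set :> set I;
  init_segP : forall i j, (i <= j)%O -> init_set j -> init_set i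
}.

(* [Old i] is the element [i] of [I]; [New S] is the symbol [i_S]. *)
Inductive sme_index d (I : orderType d) : Type :=
  | Old of I
  | New of init_seg I.
Arguments Old {d I} _.
Arguments New {d I} _.

Section SmeIndex.
Context d (I : orderType d).
Implicit Types (S T : init_seg I) (a b c : sme_index I).

HB.instance Definition _ := gen_eqMixin (sme_index I).
HB.instance Definition _ := gen_choiceMixin (sme_index I).

Lemma init_seg_ext S T : (S : set I) = T -> S = T.
Proof.
case: S T => [S pS] [T pT] /= eST; subst T.
by rewrite (Prop_irrelevance pS pT).
Qed.

Lemma init_seg_total S T : S `<=` T \/ T `<=` S.
Proof.
have [|nST] := pselect (S `<=` T); [by left|right => i Ti].
have [j [Sj nTj]] : exists j, init_set S j /\ ~ init_set T j.
  apply: contrapT => no; apply: nST => j Sj; apply: contrapT => nTj.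
  by apply: no; exists j.
have [ij|ji] := leP i j; first exact: init_segP ij Sj.
by case: nTj; exact: init_segP (ltW ji) Ti.
Qed.

(* The order of [S + {i_S} + (I \ S)] for each [S], and inclusion of initial
   segments on the new symbols. *)
Definition sme_index_le a b : bool :=
  match a, b with
  | Old i, Old j => (i <= j)%O
  | Old i, New T => `[< init_set T i >]
  | New T, Old i => `[< ~ init_set T i >]
  | New T, New U => `[< T `<=` U >]
  end.

Fact sme_index_le_refl : reflexive sme_index_le.
Proof. by case=> [i|S] /=; [exact: lexx|apply/asboolP]. Qed.

Fact sme_index_le_anti : antisymmetric sme_index_le.
Proof.
move=> [i|S] [j|T] /andP[].
- by move=> /= ij ji; congr Old; apply/le_anti/andP.
- by move=> /asboolP ? /asboolP.
- by move=> /asboolP ? /asboolP.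
- move=> /asboolP ST /asboolP TS; congr New; apply: init_seg_ext.
  exact/seteqP.
Qed.

Fact sme_index_le_trans : transitive sme_index_le.
Proof.
move=> [j|T] [i|S] [k|U] /=.
- exact: le_trans.
- by move=> ij /asboolP Uj; apply/asboolP; exact: init_segP ij Uj.
- move=> /asboolP nSj jk; apply/asboolP => Sk; apply: nSj.
  exact: init_segP jk Sk.
- move=> /asboolP nSj /asboolP Uj; apply/asboolP.
  have [//|US] := init_seg_total S U.
  by case: nSj; exact: US.
- move=> /asboolP Ti /asboolP nTk.
  by have [//|ki] := leP i k; case: nTk; exact: init_segP (ltW ki) Ti.
- by move=> /asboolP Ti /asboolP TU; apply/asboolP; exact: TU.
- by move=> /asboolP ST /asboolP nTk; apply/asboolP => /ST.
- by move=> /asboolP ST /asboolP TU; apply/asboolP => x /ST /TU.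
Qed.

HB.instance Definition _ := Order.Le_isPOrder.Build d (sme_index I)
  sme_index_le_refl sme_index_le_anti sme_index_le_trans.

Fact sme_index_le_total : total (<=%O : rel (sme_index I)).
Proof.
move=> [i|S] [j|T]; rewrite /Order.le /=.
- exact: le_total.
- by apply/orP; have [?|?] := pselect (init_set T i); [left|right]; apply/asboolP.
- by apply/orP; have [?|?] := pselect (init_set S j); [right|left]; apply/asboolP.
- by apply/orP; have [?|?] := init_seg_total S T; [left|right]; apply/asboolP.
Qed.

HB.instance Definition _ :=
  Order.POrder_isTotal.Build d (sme_index I) sme_index_le_total.

Definition sub_index S : set (sme_index I) :=
  [set a | (exists i, a = Old i) \/ a = New S].

End SmeIndex.

Section SmallExtensions.
Context (R : realType) d (I : orderType d).

Definition big_hahn : oagType := hahn_oag (fun _ : sme_index I => real_oag R).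

(* Extension by zero [R^I_lex -> R^II_lex]. *)
Definition hahn_ext_val (x : hahn_real R I) (a : sme_index I) : R :=
  if a is Old i then (x : hahn _) i else 0.

Fact hahn_ext_wo (x : hahn_real R I) :
  well_ordered [set a | hahn_ext_val x a != 0].
Proof.
move=> B BA [[i|S] Ba]; last by have := BA _ Ba; rewrite /= eqxx.
have [m Bm mP] := hahn_supp_wo (x : hahn _)
  [set i | B (Old i)] (fun i => BA (Old i)) (ex_intro _ i Ba).
exists (Old m) => // -[j|S] Bb; first exact: mP.
by have := BA _ Bb; rewrite /= eqxx.
Qed.

Definition hahn_ext (x : hahn_real R I) : big_hahn :=
  @Hahn _ _ (fun _ : sme_index I => real_oag R) _ (@hahn_ext_wo x).

(* The subgroup [R^{I_S}_lex] of [R^II_lex]. *)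
Definition hahn_sub (S : init_seg I) : set big_hahn :=
  [set x | forall a, (x : hahn _) a != 0 -> sub_index S a].

Definition R_sme : set big_hahn := \bigcup_S hahn_sub S.

Definition sim_sme (Gam : set big_hahn) (b c : big_hahn) : Prop :=
  [/\ R_sme b, R_sme c &
      exists f : big_hahn -> big_hahn,
        [/\ is_oag_iso (subgroup_gen (Gam `|` [set b]))
                       (subgroup_gen (Gam `|` [set c])) f,
            forall g, Gam g -> f g = g
          & f b = c]].

End SmallExtensions.

(* [option L] is [L] with a largest element [None], the infinite value. *)
Definition inf_le (L : oagType) (a b : option L) : bool :=
  match a, b with
  | _, None => true
  | None, Some _ => false
  | Some x, Some y => x <= y
  end.
Definition inf_lt (L : oagType) (a b : option L) : bool := ~~ inf_le b a.
Definition inf_min (L : oagType) (a b : option L) : option L :=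
  if inf_le a b then a else b.
Definition inf_add (L : oagType) (a b : option L) : option L :=
  if a is Some x then if b is Some y then Some (x + y) else None else None.

Record valuation (A : comPzRingType) (L : oagType) := Valuation {
  val_fun :> A -> option L;
  val1 : val_fun 1 = Some 0;
  val0 : val_fun 0 = None;
  valM : forall a b, val_fun (a * b) = inf_add (val_fun a) (val_fun b);
  valD : forall a b,
    inf_le (inf_min (val_fun a) (val_fun b)) (val_fun (a + b))
}.

Lemma valuation_ext (A : comPzRingType) (L : oagType) (mu nu : valuation A L) :
  (forall a, mu a = nu a) -> mu = nu.
Proof.
case: mu nu => [f f1 f0 fM fD] [g g1 g0 gM gD] /= efg.
have {}efg := funext efg; subst g.
by congr Valuation; exact: Prop_irrelevance.
Qed.

Definition value_group (A : comPzRingType) (L : oagType) (mu : valuation A L)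
    : set L :=
  subgroup_gen [set x | exists a, mu a = Some x].

Definition val_equiv (A : comPzRingType) (L L' : oagType)
    (mu : valuation A L) (nu : valuation A L') : Prop :=
  exists f : L -> L',
    is_oag_iso (value_group mu) (value_group nu) f /\
    forall a, nu a = omap f (mu a).

Definition val_le (A : comPzRingType) (L : oagType) (mu nu : valuation A L)
    : Prop :=
  forall f, inf_le (mu f) (nu f).

Section ValuationIdeals.
Context (A : comPzRingType) (L : oagType) (mu : valuation A L).
Implicit Types (a : L) (g h : A).

Definition val_ideal a : set A := [set g | inf_le (Some a) (mu g)].
Definition val_ideal_plus a : set A := [set g | inf_lt (Some a) (mu g)].

Lemma val_ideal0 a : val_ideal a 0.
Proof. by rewrite /val_ideal /= val0. Qed.

Lemma val_ideal_plus0 a : val_ideal_plus a 0.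
Proof. by rewrite /val_ideal_plus /inf_lt /= val0. Qed.

Lemma val_idealD a g h : val_ideal a g -> val_ideal a h -> val_ideal a (g + h).
Proof.
rewrite /val_ideal /=; have := valD mu g h; rewrite /inf_min.
case: (mu g) (mu h) (mu (g + h)) => [x|] [y|] [z|] //=.
- by case: ifP => _ /=; [move=> xz ax _|move=> xz _ ax]; exact: le_trans xz.
- by move=> xz ax _; exact: le_trans xz.
- by move=> xz _ ax; exact: le_trans xz.
Qed.

Lemma val_ideal_plusD a g h :
  val_ideal_plus a g -> val_ideal_plus a h -> val_ideal_plus a (g + h).
Proof.
rewrite /val_ideal_plus /inf_lt /=; have := valD mu g h; rewrite /inf_min.
case: (mu g) (mu h) (mu (g + h)) => [x|] [y|] [z|] //=; rewrite -?ltNge.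
- by case: ifP => _ /=; [move=> xz ax _|move=> xz _ ax]; exact: lt_le_trans xz.
- by move=> xz ax _; exact: lt_le_trans xz.
- by move=> xz _ ax; exact: lt_le_trans xz.
Qed.

Lemma val_idealM a b g h :
  val_ideal a g -> val_ideal b h -> val_ideal (a + b) (g * h).
Proof.
rewrite /val_ideal /= valM; case: (mu g) (mu h) => [x|] [y|] //= ax by_.
by apply: (@le_trans _ _ (a + y)); rewrite ?oag_leD2lE // ![_ + y]addrC oag_leD2lE.
Qed.

Lemma val_ideal_plusM a b g h :
  val_ideal a g -> val_ideal_plus b h -> val_ideal_plus (a + b) (g * h).
Proof.
rewrite /val_ideal /val_ideal_plus /inf_lt /= valM.
case: (mu g) (mu h) => [x|] [y|] //=; rewrite -!ltNge => ax by_.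
by apply: (@lt_le_trans _ _ (a + y)); rewrite ?oag_ltD2lE // ![_ + y]addrC oag_leD2lE.
Qed.

Lemma val_opp g : mu (- g) = mu g.
Proof.
have m1 : mu (-1) = Some 0.
  have := valM mu (-1) (-1); rewrite mulrNN mulr1 val1.
  case: (mu (-1)) => [x|] //= [/esym xx]; congr Some; apply/eqP.
  rewrite eq_le; apply/andP; split; rewrite leNgt; apply/negP => x0.
    by have := x0; rewrite -(oag_ltD2lE x) xx addr0 => /(lt_trans x0); rewrite ltxx.
  by have := x0; rewrite -(oag_ltD2lE x) xx addr0 => /lt_trans /(_ x0); rewrite ltxx.
rewrite -mulN1r valM m1; case: (mu g) => [x|] //=.
by rewrite add0r.
Qed.

Lemma val_ideal_plusN a g : val_ideal_plus a g -> val_ideal_plus a (- g).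
Proof. by rewrite /val_ideal_plus /= val_opp. Qed.

Lemma value_group_subgroup : is_subgroup (value_group mu).
Proof.
split=> [H [[H0 _] _] //|x y Gx Gy H [HH XH]].
by apply HH.2; [exact: Gx|exact: Gy].
Qed.

Lemma value_groupD a b :
  value_group mu a -> value_group mu b -> value_group mu (a + b).
Proof.
have [G0 GB] := value_group_subgroup => Ga Gb.
by rewrite -[b]opprK; apply: (GB _ _ Ga); rewrite -sub0r; apply: GB.
Qed.

Lemma value_group_val g a : mu g = Some a -> value_group mu a.
Proof. by move=> ga; apply: sub_gen_smallest; exists g. Qed.

Lemma val_ideal_val g a : mu g = Some a -> val_ideal a g.
Proof. by rewrite /val_ideal /= => ->; rewrite /= lexx. Qed.

(* A homogeneous element of degree [a] in the value group, given by a
   representative in [val_ideal a] of a class modulo [val_ideal_plus a]. *)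
Record hom_elt := HomElt {
  hdeg : L;
  hrep : A;
  hdegP : value_group mu hdeg;
  hrepP : val_ideal hdeg hrep
}.

HB.instance Definition _ := gen_eqMixin hom_elt.
HB.instance Definition _ := gen_choiceMixin hom_elt.

Implicit Types s t u : seq hom_elt.

Definition hom_component a s : A := \sum_(e <- s | hdeg e == a) hrep e.

(* Two finite formal sums of homogeneous elements define the same element of
   the direct sum of the quotients [val_ideal a / val_ideal_plus a]. *)
Definition gr_eq s t : bool :=
  `[< forall a, val_ideal_plus a (hom_component a s - hom_component a t) >].

Lemma gr_eqP s t : reflect
  (forall a, val_ideal_plus a (hom_component a s - hom_component a t))
  (gr_eq s t).
Proof. exact: asboolP. Qed.

Lemma gr_eq_comp s t :
  (forall a, hom_component a s = hom_component a t) -> gr_eq s t.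
Proof. by move=> st; apply/gr_eqP => a; rewrite st subrr; exact: val_ideal_plus0. Qed.

Fact gr_eq_refl : reflexive gr_eq.
Proof. by move=> s; exact: gr_eq_comp. Qed.

Fact gr_eq_sym : symmetric gr_eq.
Proof.
by move=> s t; apply/gr_eqP/gr_eqP => st a; rewrite -opprB; apply: val_ideal_plusN.
Qed.

Fact gr_eq_trans : transitive gr_eq.
Proof.
move=> t s u /gr_eqP st /gr_eqP tu; apply/gr_eqP => a.
by have := val_ideal_plusD (st a) (tu a); rewrite addrA subrK.
Qed.

Canonical gr_eq_equiv := EquivRel gr_eq gr_eq_refl gr_eq_sym gr_eq_trans.

Definition graded := {eq_quot gr_eq_equiv}%qT.
HB.instance Definition _ := Choice.on graded.
HB.instance Definition _ := EqQuotient.on graded.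

Lemma gr_piP s t : gr_eq s t -> \pi_graded%qT s = \pi_graded%qT t.
Proof. by move=> st; apply/eqmodP. Qed.

Lemma gr_repr s : gr_eq (repr (\pi_graded%qT s)) s.
Proof. by have /eqmodP := reprK (\pi_graded%qT s). Qed.

Definition hom_opp_elt (e : hom_elt) : hom_elt.
Proof.
apply: (@HomElt (hdeg e) (- hrep e) (hdegP e)).
by rewrite /val_ideal /= val_opp; exact: hrepP.
Defined.

Definition hom_mul (e f : hom_elt) : hom_elt :=
  HomElt (value_groupD (hdegP e) (hdegP f)) (val_idealM (hrepP e) (hrepP f)).

Fact one_deg_group : value_group mu 0.
Proof. exact: value_group_val (val1 mu). Qed.
Fact one_rep_ideal : val_ideal 0 1.
Proof. exact: val_ideal_val (val1 mu). Qed.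
Definition hom_one : hom_elt := HomElt one_deg_group one_rep_ideal.

Definition gsum_mul s t : seq hom_elt := [seq hom_mul e f | e <- s, f <- t].

Definition gr_zero : graded := \pi_graded%qT [::].
Definition gr_one : graded := \pi_graded%qT [:: hom_one].
Definition gr_add (x y : graded) : graded := \pi_graded%qT (repr x ++ repr y).
Definition gr_opp (x : graded) : graded :=
  \pi_graded%qT [seq hom_opp_elt e | e <- repr x].
Definition gr_mul (x y : graded) : graded :=
  \pi_graded%qT (gsum_mul (repr x) (repr y)).

Lemma component_cat a s t :
  hom_component a (s ++ t) = hom_component a s + hom_component a t.
Proof. exact: big_cat. Qed.

Lemma component_opp a s :
  hom_component a [seq hom_opp_elt e | e <- s] = - hom_component a s.
Proof. by rewrite /hom_component big_map sumrN. Qed.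

Lemma component_mul a s t :
  hom_component a (gsum_mul s t) =
  \sum_(e <- s) hrep e * hom_component (a - hdeg e) t.
Proof.
rewrite /hom_component /gsum_mul big_mkcond big_allpairs_dep /=.
apply: eq_bigr => e _; rewrite -big_mkcond big_distrr /=.
by apply: eq_bigl => f; rewrite [RHS]eq_sym subr_eq eq_sym addrC.
Qed.

Lemma gsum_mulC s t : gr_eq (gsum_mul s t) (gsum_mul t s).
Proof.
apply: gr_eq_comp => a; rewrite /hom_component /gsum_mul.
rewrite big_mkcond big_allpairs_dep exchange_big /=.
rewrite [RHS]big_mkcond big_allpairs_dep /=.
by apply: eq_bigr => e _; apply: eq_bigr => f _; rewrite addrC mulrC.
Qed.

Lemma gsum_mulr s t t' : gr_eq t t' -> gr_eq (gsum_mul s t) (gsum_mul s t').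
Proof.
move=> /gr_eqP tt'; apply/gr_eqP => a; rewrite !component_mul -sumrB.
elim: s => [|e s IH]; first by rewrite big_nil; exact: val_ideal_plus0.
rewrite big_cons; apply: val_ideal_plusD => //.
rewrite -mulrBr -[X in val_ideal_plus X](subrK (hdeg e)) addrC.
by apply: val_ideal_plusM => //; exact: hrepP.
Qed.

Lemma gsum_mull s s' t : gr_eq s s' -> gr_eq (gsum_mul s t) (gsum_mul s' t).
Proof.
move=> ss'; apply: gr_eq_trans (gsum_mulC s t) _.
by apply: gr_eq_trans (gsum_mulC t s'); exact: gsum_mulr.
Qed.

Lemma gsum_cat s s' t t' :
  gr_eq s s' -> gr_eq t t' -> gr_eq (s ++ t) (s' ++ t').
Proof.
move=> /gr_eqP ss /gr_eqP tt; apply/gr_eqP => a; rewrite !component_cat.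
by have := val_ideal_plusD (ss a) (tt a); rewrite opprD addrACA.
Qed.

Lemma gr_addE s t :
  gr_add (\pi_graded%qT s) (\pi_graded%qT t) = \pi_graded%qT (s ++ t).
Proof. by apply: gr_piP; apply: gsum_cat; exact: gr_repr. Qed.

Lemma gr_mulE s t :
  gr_mul (\pi_graded%qT s) (\pi_graded%qT t) = \pi_graded%qT (gsum_mul s t).
Proof.
apply: gr_piP; apply: gr_eq_trans (gsum_mulr _ (gr_repr t)).
exact: gsum_mull (gr_repr s).
Qed.

Fact gr_addA : associative gr_add.
Proof.
elim/quotW=> x; elim/quotW=> y; elim/quotW=> z; rewrite (gr_addE y z).
by rewrite (gr_addE x (y ++ z)) (gr_addE x y) (gr_addE (x ++ y) z) catA.
Qed.
Fact gr_addC : commutative gr_add.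
Proof.
elim/quotW=> x; elim/quotW=> y; rewrite !gr_addE.
apply: gr_piP; apply: gr_eq_comp => a.
by rewrite !component_cat addrC.
Qed.
Fact gr_add0 : left_id gr_zero gr_add.
Proof. by elim/quotW=> x; rewrite gr_addE. Qed.
Fact gr_addN : left_inverse gr_zero gr_opp gr_add.
Proof.
move=> x; rewrite -[X in gr_add _ X]reprK gr_addE.
apply: gr_piP; apply: gr_eq_comp => a.
by rewrite component_cat component_opp addNr /hom_component big_nil.
Qed.

HB.instance Definition _ :=
  GRing.isZmodule.Build graded gr_addA gr_addC gr_add0 gr_addN.

Fact gr_mulA : associative gr_mul.
Proof.
elim/quotW=> x; elim/quotW=> y; elim/quotW=> z.
rewrite (gr_mulE y z) (gr_mulE x y) (gr_mulE x (gsum_mul y z)).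
rewrite (gr_mulE (gsum_mul x y) z).
apply: gr_piP; apply: gr_eq_comp => a.
rewrite !component_mul /gsum_mul big_allpairs_dep.
apply: eq_bigr => e _; rewrite component_mul mulr_sumr /=.
by apply: eq_bigr => f _; rewrite mulrA opprD addrA.
Qed.
Fact gr_mulC : commutative gr_mul.
Proof.
elim/quotW=> x; elim/quotW=> y; rewrite !gr_mulE.
by apply: gr_piP; exact: gsum_mulC.
Qed.
Fact gr_mul1 : left_id gr_one gr_mul.
Proof.
elim/quotW=> x; rewrite gr_mulE; apply: gr_piP; apply: gr_eq_comp => a.
by rewrite component_mul big_seq1 /= mul1r subr0.
Qed.
Fact gr_mulDl : left_distributive gr_mul gr_add.
Proof.
elim/quotW=> x; elim/quotW=> y; elim/quotW=> z.
rewrite (gr_addE x y) (gr_mulE (x ++ y) z) (gr_mulE x z) (gr_mulE y z).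
rewrite (gr_addE (gsum_mul x z) (gsum_mul y z)).
apply: gr_piP; apply: gr_eq_comp => a.
by rewrite component_cat !component_mul big_cat.
Qed.
Fact gr_one_neq0 : gr_one != 0.
Proof.
apply/eqP => /eqmodP /gr_eqP /(_ 0).
rewrite /hom_component big_nil big_mkcond big_seq1 /= eqxx subr0.
by rewrite /val_ideal_plus /inf_lt /= val1 /= lexx.
Qed.

HB.instance Definition _ := GRing.Zmodule_isComNzRing.Build graded
  gr_mulA gr_mulC gr_mul1 gr_mulDl gr_one_neq0.

(* The homogeneous element [g + val_ideal_plus (mu g)] if [mu g] is finite,
   and [0] on the support of [mu]. *)
Definition initial_term (g : A) : graded :=
  match mu g as o return mu g = o -> graded with
  | Some a => fun ga =>
      \pi_graded%qT [:: HomElt (value_group_val ga) (val_ideal_val ga)]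
  | None => fun _ => 0
  end erefl.

End ValuationIdeals.

Definition ring_divides (B : comPzRingType) (b c : B) : Prop :=
  exists q, c = b * q.

Definition principal_ideal (B : comPzRingType) (b : B) : set B :=
  [set c | ring_divides b c].

Definition is_prime_ideal (B : comPzRingType) (J : set B) : Prop :=
  [/\ J 0, forall x y, J x -> J y -> J (x + y),
      forall x y, J y -> J (x * y),
      ~ J 1
    & forall x y, J (x * y) -> J x \/ J y].

(* [pdeg 0 = 0]; comparing with the degree of a key polynomial, which is
   positive, this agrees with giving [0] the degree [-oo]. *)
Definition pdeg (K : fieldType) (f : {poly K}) : nat := (size f).-1.

Section KeyPolynomials.
Context (K : fieldType) (L : oagType) (mu : valuation {poly K} L).
Implicit Types f g h phi : {poly K}.

Definition mu_divides h g : Prop :=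
  ring_divides (initial_term mu h) (initial_term mu g).

Definition mu_irreducible g : Prop :=
  principal_ideal (initial_term mu g) <> [set 0] /\
  is_prime_ideal (principal_ideal (initial_term mu g)).

Definition mu_minimal g : Prop :=
  forall f, f != 0 -> (pdeg f < pdeg g)%N -> ~ mu_divides g f.

Definition KP : set {poly K} :=
  [set phi | [/\ phi \is monic, mu_minimal phi & mu_irreducible phi]].

Definition min_KP : set {poly K} :=
  [set phi | KP phi /\ forall psi, KP psi -> (pdeg phi <= pdeg psi)%N].

(* A choice of a key polynomial of minimal degree, when there is one. *)
Definition some_min_KP : {poly K} := xget 0 min_KP.

Definition node_deg : nat := pdeg some_min_KP.

(* Key polynomials have finite value, because their initial term is nonzero;
   so the default value is never used when [KP] is nonempty. *)
Definition sv : L := odflt 0 (mu some_min_KP).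

End KeyPolynomials.

Section Trees.
Context (K : fieldType) (L : oagType) (w : K -> option L).
Implicit Types mu nu : valuation {poly K} L.

Definition tree : set (valuation {poly K} L) :=
  [set mu | forall a : K, mu a%:P = w a].

Definition is_leaf mu : Prop :=
  tree mu /\ forall nu, tree nu -> val_le mu nu -> nu = mu.

Definition is_inner mu : Prop := tree mu /\ ~ is_leaf mu.

End Trees.

Definition tree0 (R : realType) d (I : orderType d) (K : fieldType)
    (w : K -> option (big_hahn R I)) : set (valuation {poly K} (big_hahn R I)) :=
  [set rho | tree w rho /\ exists S, value_group rho `<=` @hahn_sub R d I S].

(* Composition of the embeddings
   [Gamma -> Gamma_QQ -> H(Gamma_QQ) -> R^I_lex -> R^II_lex].
   The second one is only asked to be additive: between divisible torsion-free
   groups this is the same as being QQ-linear. *)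
Definition base_embedding (Gam GQ : oagType) (j : {additive Gam -> GQ})
    d (I : orderType d) (Q : I -> oagType) (h : {additive GQ -> hahn Q})
    (R : realType) (t : forall i, {additive Q i -> R}) (g : Gam)
    : big_hahn R I :=
  hahn_ext (hahn_map t (h (j g))).

(* Main.v *)
Require Import Defs.
From HB Require Import structures.
From mathcomp Require Import all_boot all_order all_algebra.
From mathcomp Require Import boolp classical_sets reals.
(* After this import [inf_le] is the order on values again, not the homonymous
   lemma about infima of sets of reals. *)
Import Defs.

Set Implicit Arguments.
Unset Strict Implicit.
Unset Printing Implicit Defensive.

Import Order.TTheory GRing.Theory Num.Theory.

Local Open Scope classical_set_scope.
Local Open Scope ring_scope.

(** The initial term of [g] divides that of [f] exactly when [mu f] is infinite
    or some [q] satisfies [mu f < mu (f - g q)] ([initial_term_dividesP]).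
    Since the graded algebra is graded by an ordered group, the initial term of
    [g] generates a prime ideal as soon as primality holds for homogeneous
    elements ([principal_ideal_prime]).  Hence being a key polynomial only
    depends on comparisons between values, and equivalent valuations have the
    same key polynomials ([val_equiv_KP]).

    An inner node [mu] has a key polynomial: if [mu < rho], take a monic [phi] of
    minimal degree with [mu phi < rho phi] ([val_lt_KP]).  For any key
    polynomial [phi], two facts describe [mu].
    - Division with remainder computes [mu]: if [f = r + q phi] then
      [mu f = min (mu r) (mu q + mu phi)] ([val_divp_modp]).
    - The values in degree smaller than [deg phi] are torsion over the value
      group [Gamma] of [K], because they are values of a valuation on the finite
      extension [K[x]/(phi)] ([small_val_torsion]).

    If [mu] and [nu] are equivalent, the isomorphism fixes [Gamma], hence the
    torsion hull of [Gamma], since ordered groups are torsion-free; this gives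
    the equality of values in small degree.  Its restriction to the subgroup
    generated by [Gamma] and [sv mu] relates [sv mu] to [sv nu]
    ([val_equiv_conditions]).

    Conversely, let [b = mu phi] and [b' = nu phi].  The sign of [a + n b], with
    [a] torsion over [Gamma], is that of a positive multiple of it, which lies
    in the subgroup generated by [Gamma] and [b]; so it agrees with the sign of
    [a + n b'].  Thus [a + n b |-> a + n b'] is a well-defined isomorphism of
    ordered groups, and by induction on the degree it carries [mu] to [nu]
    ([span_map_equiv]). *)

(** * Ordered groups with a largest element *)

Section InfOrder.
Context (L : oagType).
Implicit Types (x y z : L) (a b c : option L).

Lemma oag_leD2r z x y : (x + z <= y + z) = (x <= y).
Proof. by rewrite ![_ + z]addrC oag_leD2lE. Qed.

Lemma oag_subr_ge0 x y : (0 <= y - x) = (x <= y).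
Proof. by rewrite -(oag_leD2r x 0) add0r subrK. Qed.

Lemma oag_mulrn_ge0 x n : (0 < n)%N -> (0 <= x *+ n) = (0 <= x).
Proof.
have ge0 z m : 0 <= z -> 0 <= z *+ m.
  move=> z0; elim: m => [|m IH]; first by rewrite mulr0n.
  by rewrite mulrS -[0]addr0; apply: le_trans (oag_leD2l z IH); rewrite oag_leD2r.
case: n => // n _; apply/idP/idP => [xn|/ge0 //].
rewrite leNgt; apply/negP => x0; move: xn; rewrite leNgt => /negP; apply.
apply: (@le_lt_trans _ _ x) => //.
rewrite mulrS -[leRHS]addr0 oag_leD2lE -oag_subr_ge0 sub0r -mulNrn.
by apply: ge0; rewrite -sub0r oag_subr_ge0 ltW.
Qed.

Lemma oag_mulrn_inj x y n : (0 < n)%N -> x *+ n = y *+ n -> x = y.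
Proof.
move=> n0 xy; apply/le_anti; rewrite -(oag_subr_ge0 x y) -(oag_subr_ge0 y x).
by rewrite -!(oag_mulrn_ge0 (_ - _) n0) !mulrnBl xy subrr lexx.
Qed.

Lemma inf_le_refl a : inf_le a a.
Proof. by case: a => //= x; rewrite lexx. Qed.

Lemma inf_le_trans b a c : inf_le a b -> inf_le b c -> inf_le a c.
Proof. by case: a b c => [x|] [y|] [z|] //=; exact: le_trans. Qed.

Lemma inf_le_anti a b : inf_le a b -> inf_le b a -> a = b.
Proof.
by case: a b => [x|] [y|] //= xy yx; congr Some; apply/le_anti; rewrite xy.
Qed.

Lemma inf_le_total a b : inf_le a b || inf_le b a.
Proof. by case: a b => [x|] [y|] //=; exact: le_total. Qed.

Lemma inf_ltW a b : inf_lt a b -> inf_le a b.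
Proof.
have := inf_le_total a b; rewrite /inf_lt.
by case: (inf_le b a) => //; rewrite orbF.
Qed.

Lemma inf_leNlt a b : inf_le a b = ~~ inf_lt b a.
Proof. by rewrite /inf_lt negbK. Qed.

Lemma inf_lt_irr a : ~~ inf_lt a a.
Proof. by rewrite /inf_lt inf_le_refl. Qed.

Lemma inf_lt_le_trans b a c : inf_lt a b -> inf_le b c -> inf_lt a c.
Proof. by move=> ab bc; apply: contra ab => /(inf_le_trans bc). Qed.

Lemma inf_le_lt_trans b a c : inf_le a b -> inf_lt b c -> inf_lt a c.
Proof. by move=> ab; apply: contra => ca; exact: inf_le_trans ca ab. Qed.

Lemma inf_leD2r c a b : inf_le a b -> inf_le (inf_add a c) (inf_add b c).
Proof. by case: a b c => [x|] [y|] [z|] //=; rewrite oag_leD2r. Qed.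

Lemma inf_ltD2r z a b :
  inf_lt a b -> inf_lt (inf_add a (Some z)) (inf_add b (Some z)).
Proof. by case: a b => [x|] [y|] //=; rewrite /inf_lt /= oag_leD2r. Qed.

Lemma inf_addC a b : inf_add a b = inf_add b a.
Proof. by case: a b => [x|] [y|] //=; rewrite addrC. Qed.

End InfOrder.

(** * Values of sums *)

Section ValuationTheory.
Context (A : comPzRingType) (L : oagType) (mu : valuation A L).
Implicit Types (f g q : A) (c : option L).

Lemma val_le_add c f g :
  inf_le c (mu f) -> inf_le c (mu g) -> inf_le c (mu (f + g)).
Proof.
move=> cf cg; apply: inf_le_trans (valD mu f g).
by rewrite /inf_min; case: ifP.
Qed.

Lemma val_lt_add c f g :
  inf_lt c (mu f) -> inf_lt c (mu g) -> inf_lt c (mu (f + g)).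
Proof.
move=> cf cg; apply: inf_lt_le_trans (valD mu f g).
by rewrite /inf_min; case: ifP.
Qed.

(** If [mu f < mu g] then [f] dominates the sum. *)
Lemma valD_lt f g : inf_lt (mu f) (mu g) -> mu (f + g) = mu f.
Proof.
move=> fg; apply: inf_le_anti; last first.
  by apply: val_le_add; [exact: inf_le_refl|exact: inf_ltW].
rewrite inf_leNlt; apply/negP => lt_f.
have : inf_lt (mu f) (mu (f + g - g)) by apply: val_lt_add; rewrite ?val_opp.
by rewrite addrK (negbTE (inf_lt_irr _)).
Qed.

Lemma valD_inf f g : mu g = None -> mu (f + g) = mu f.
Proof.
move=> g0; case fE: (mu f) => [x|]; first by rewrite valD_lt ?fE ?g0.
by have := valD mu f g; rewrite fE g0 /=; case: (mu _).
Qed.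

Lemma val_mul_fin f g x :
  mu (f * g) = Some x -> exists y z, [/\ mu f = Some y, mu g = Some z & x = y + z].
Proof.
by rewrite valM; case: (mu f) (mu g) => [y|] [z|] //= [<-]; exists y, z.
Qed.

Lemma val_sum_plus (a : L) (J : Type) (r : seq J) (P : pred J) (F : J -> A) :
  (forall j, P j -> val_ideal_plus mu a (F j)) ->
  val_ideal_plus mu a (\sum_(j <- r | P j) F j).
Proof.
move=> PF; apply: (big_ind (val_ideal_plus mu a)) => //.
  exact: val_ideal_plus0.
by move=> f g; exact: val_ideal_plusD.
Qed.

(** A vanishing finite sum has two terms of equal finite value, as soon as one
    of its terms has finite value. *)
Lemma val_sum0 (n : nat) (F : 'I_n -> A) (i0 : 'I_n) :
  \sum_i F i = 0 -> mu (F i0) <> None ->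
  exists i j : 'I_n, [/\ (i < j)%N, mu (F i) = mu (F j) & mu (F i) <> None].
Proof.
move=> F0 Fi0.
have [i iP] : exists i, forall j, inf_le (mu (F i)) (mu (F j)).
  have [i /allP iP] :
      exists i, all (fun j => inf_le (mu (F i)) (mu (F j))) (enum 'I_n).
    elim: (enum _) => [|k s [i iP]]; first by exists i0.
    have [ik|ki] := orP (inf_le_total (mu (F i)) (mu (F k))).
      by exists i; rewrite /= ik.
    exists k; rewrite /= inf_le_refl /=; apply: sub_all iP => j.
    exact: inf_le_trans.
  by exists i => j; apply: iP; rewrite mem_enum.
have [x Fi] : exists x, mu (F i) = Some x.
  by have := iP i0; case: (mu (F i)) => [x|]; [exists x|case: (mu _) Fi0].
(* A unique term of minimal value would have the same value as minus the sum of
   the others, which is strictly larger. *)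
have [j ji Fij] : exists2 j, j != i & mu (F i) = mu (F j).
  apply: contrapT => no.
  have : val_ideal_plus mu x (\sum_(j | j != i) F j).
    apply: val_sum_plus => j ji; rewrite /val_ideal_plus /= -Fi.
    by apply/negP => le_ji; apply: no; exists j => //; exact: inf_le_anti.
  have -> : \sum_(j | j != i) F j = - F i.
    have := F0; rewrite (bigD1 i) //= => /(congr1 (+%R (- F i))).
    by rewrite addKr addr0.
  by rewrite /val_ideal_plus /= val_opp Fi (negbTE (inf_lt_irr _)).
have [lt_ij|lt_ji|/val_inj eij] := ltngtP i j.
- by exists i, j; split=> //; rewrite Fi.
- by exists j, i; split; rewrite -?Fij ?Fi.
- by rewrite eij eqxx in ji.
Qed.

Lemma value_groupB a b :
  value_group mu a -> value_group mu b -> value_group mu (a - b).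
Proof. exact: (value_group_subgroup mu).2. Qed.

End ValuationTheory.

(** * Homogeneous divisibility in the graded algebra *)

Section GradedAlgebra.
Context (A : comPzRingType) (L : oagType) (mu : valuation A L).
Implicit Types (f g h q : A) (a b gam : L).

(** For [gam] the value of [g] and [c] of value at least [a], this says that the
    class of [c] in degree [a] is a multiple of the initial term of [g]; the
    class may be zero. *)
Definition hom_divides g gam a (c : A) : Prop :=
  exists2 q, val_ideal mu (a - gam) q & val_ideal_plus mu a (c - g * q).

Lemma initial_term_None g : mu g = None -> initial_term mu g = 0.
Proof.
rewrite /initial_term; move: (erefl (mu g)).
by case: {2 4}(mu g) => // x gx; rewrite gx.
Qed.

Lemma hom_component1 a (e : hom_elt mu) :
  hom_component a [:: e] = if hdeg e == a then hrep e else 0.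
Proof. by rewrite /hom_component big_mkcond big_seq1. Qed.

Lemma initial_term_hom (e : hom_elt mu) :
  mu (hrep e) = Some (hdeg e) ->
  initial_term mu (hrep e) = \pi_(graded mu)%qT [:: e].
Proof.
case: e => a g aP gP /= ga; rewrite /initial_term; move: (erefl (mu g)).
case: {2 3}(mu g) => [x|] gx; last by rewrite gx in ga.
have ax : x = a by move: ga; rewrite gx => -[].
apply: gr_piP; apply: gr_eq_comp => b.
by rewrite !hom_component1 /= ax.
Qed.

Lemma hom_component_nil a : hom_component a ([::] : seq (hom_elt mu)) = 0.
Proof. by rewrite /hom_component big_nil. Qed.

Lemma hom_component_ideal a (s : seq (hom_elt mu)) :
  val_ideal mu a (hom_component a s).
Proof.
rewrite /hom_component; apply: (big_ind (val_ideal mu a)).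
- exact: val_ideal0.
- by move=> f g; exact: val_idealD.
- by move=> e /eqP <-; exact: hrepP.
Qed.

Lemma hom_component_filter a b (s : seq (hom_elt mu)) :
  hom_component b [seq e <- s | hdeg e == a] =
  if a == b then hom_component b s else 0.
Proof.
rewrite /hom_component big_filter_cond.
case: eqVneq => [->|ab].
  by apply: eq_bigl => e; rewrite andbb.
rewrite big1 // => e /andP[/eqP -> ea].
by rewrite ea in ab.
Qed.

Lemma hom_component_split a b (s : seq (hom_elt mu)) :
  hom_component b s = hom_component b [seq e <- s | hdeg e == a] +
                      hom_component b [seq e <- s | hdeg e != a].
Proof.
rewrite {1}/hom_component (bigID (fun e => hdeg e == a)) /= /hom_component.
by rewrite !big_filter_cond; congr (_ + _); apply: eq_bigl => e; rewrite andbC.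
Qed.

Lemma pi_split a (s : seq (hom_elt mu)) :
  \pi_(graded mu)%qT s =
  \pi_(graded mu)%qT [seq e <- s | hdeg e == a] +
  \pi_(graded mu)%qT [seq e <- s | hdeg e != a].
Proof.
rewrite -[RHS]/(gr_add _ _) gr_addE; apply: gr_piP; apply: gr_eq_comp => b.
by rewrite component_cat -hom_component_split.
Qed.

(** The ideal generated by the initial term of [g] is homogeneous: membership is
    tested on components. *)
Lemma principal_ideal_hom_divides g gam (s : seq (hom_elt mu)) :
  mu g = Some gam ->
  principal_ideal (initial_term mu g) (\pi_(graded mu)%qT s) <->
  forall a, hom_divides g gam a (hom_component a s).
Proof.
move=> ggam.
pose e := HomElt (value_group_val ggam) (val_ideal_val ggam).
rewrite (@initial_term_hom e ggam); split.
  case=> y; rewrite -[y]reprK -[_ * _]/(gr_mul _ _) gr_mulE.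
  move=> /eqmodP /gr_eqP sP a; exists (hom_component (a - gam) (repr y)).
    exact: hom_component_ideal.
  by have := sP a; rewrite component_mul big_seq1.
(* Conversely, split off the terms of one degree [a] at a time. *)
have [n] := ubnP (size s); elim: n s => // n IH [|e1 s1] sn sP.
  by exists 0; rewrite mulr0.
set s := e1 :: s1 in sn sP *; set a := hdeg e1.
have [q qP gq] := sP a.
rewrite (pi_split a s).
have [y1 Ey1] : principal_ideal (\pi_(graded mu)%qT [:: e])
    (\pi_(graded mu)%qT [seq e0 <- s | hdeg e0 == a]).
  exists (\pi_(graded mu)%qT
    [:: HomElt (value_groupB (hdegP e1) (value_group_val ggam)) qP]).
  rewrite -[_ * _]/(gr_mul _ _) gr_mulE; apply: gr_piP; apply/gr_eqP => b.
  rewrite hom_component_filter component_mul big_seq1 hom_component1 /=.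
  rewrite (inj_eq (addIr _)).
  case: eqVneq => [<-//|_]; rewrite mulr0 subrr; exact: val_ideal_plus0.
have [||y2 Ey2] := IH [seq e0 <- s | hdeg e0 != a].
- rewrite /= eqxx size_filter /=; apply: leq_ltn_trans (count_size _ _) _.
  exact: sn.
- move=> b; have [q2 q2P gq2] := sP b.
  move: (hom_component_split a b s); rewrite hom_component_filter.
  case: eqVneq => [eb|_].
    move/eqP; rewrite -subr_eq0 opprD addrA subrr sub0r oppr_eq0 => /eqP ->.
    exists 0; first exact: val_ideal0.
    by rewrite mulr0 subrr; exact: val_ideal_plus0.
  by rewrite add0r => <-; exists q2.
- by exists (y1 + y2); rewrite Ey1 Ey2 mulrDr.
Qed.

Lemma hom_divides_plus g gam a c : val_ideal_plus mu a c -> hom_divides g gam a c.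
Proof. by exists 0; [exact: val_ideal0|rewrite mulr0 subr0]. Qed.

End GradedAlgebra.

Section InitialTermDivisibility.
Context (A : comPzRingType) (L : oagType) (mu : valuation A L).
Implicit Types (f g h q : A) (a b gam : L).

Lemma initial_term_neq0 g a : mu g = Some a -> initial_term mu g <> 0.
Proof.
move=> ga; pose e := HomElt (value_group_val ga) (val_ideal_val ga).
rewrite (@initial_term_hom _ _ mu e ga) => /eqmodP /gr_eqP /(_ a).
rewrite hom_component1 eqxx hom_component_nil subr0 /val_ideal_plus /= ga.
by rewrite (negbTE (inf_lt_irr _)).
Qed.

Lemma initial_termM f g :
  initial_term mu (f * g) = initial_term mu f * initial_term mu g.
Proof.
case fE: (mu f) => [a|]; last first.
  by rewrite (initial_term_None fE) mul0r initial_term_None // valM fE.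
case gE: (mu g) => [b|]; last first.
  by rewrite (initial_term_None gE) mulr0 initial_term_None // valM fE gE.
pose e1 := HomElt (value_group_val fE) (val_ideal_val fE).
pose e2 := HomElt (value_group_val gE) (val_ideal_val gE).
rewrite (@initial_term_hom _ _ mu e1 fE) (@initial_term_hom _ _ mu e2 gE).
have fgE : mu (hrep (hom_mul e1 e2)) = Some (hdeg (hom_mul e1 e2)).
  by rewrite /= valM fE gE.
by rewrite (initial_term_hom fgE) -[RHS]/(gr_mul _ _) gr_mulE.
Qed.

Lemma initial_term1 : initial_term mu 1 = 1.
Proof. exact: (@initial_term_hom _ _ mu (hom_one mu) (val1 mu)). Qed.

Lemma divides_hom_divides g f gam a :
  mu g = Some gam -> mu f = Some a ->
  ring_divides (initial_term mu g) (initial_term mu f) <-> hom_divides mu g gam a f.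
Proof.
move=> ggam fa; pose e := HomElt (value_group_val fa) (val_ideal_val fa).
rewrite (@initial_term_hom _ _ mu e fa).
have [J1 J2] := principal_ideal_hom_divides [:: e] ggam.
split=> [/J1/(_ a)|gf]; first by rewrite hom_component1 eqxx.
apply: J2 => b; rewrite hom_component1 /=; case: eqVneq => [<-//|_].
apply: hom_divides_plus; exact: val_ideal_plus0.
Qed.

(** Divisibility of initial terms only depends on the comparison of values. *)
Lemma initial_term_dividesP g f :
  ring_divides (initial_term mu g) (initial_term mu f) <->
  mu f = None \/ exists q, inf_lt (mu f) (mu (f - g * q)).
Proof.
case fE: (mu f) => [a|]; last first.
  split; first by left.
  by exists 0; rewrite mulr0 initial_term_None.
case gE: (mu g) => [gam|]; last first.
  split=> [[y]|[//|[q]]].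
    by rewrite (initial_term_None gE) mul0r => /(initial_term_neq0 fE).
  rewrite valD_inf ?fE ?(negbTE (inf_lt_irr _)) // val_opp valM gE //.
rewrite (divides_hom_divides gE fE); split=> [[q _ fq]|[//|[q fq]]].
  by right; exists q.
exists q => //; have gqE : mu (g * q) = Some a.
  rewrite -[g * q](subKr f) valD_lt // val_opp fE //.
have [x [y [gx qy ->]]] := val_mul_fin gqE.
move: gx; rewrite gE => -[->]; rewrite addrC addKr.
exact: val_ideal_val.
Qed.

Lemma exists_top_degree (e0 : hom_elt mu) s :
  exists2 a, has (fun e => hdeg e == a) (e0 :: s) &
             all (fun e : hom_elt mu => hdeg e <= a) (e0 :: s).
Proof.
elim: s => [|e s [a /= ha aa]].
  by exists (hdeg e0); rewrite /= ?eqxx // lexx.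
have [le_ea|lt_ae] := leP (hdeg e) a.
  exists a => /=; first by case/orP: ha => ->; rewrite ?orbT.
  by case/andP: aa => -> ->; rewrite le_ea.
exists (hdeg e) => /=; first by rewrite eqxx orbT.
case/andP: aa => e0a sa; rewrite lexx (le_trans e0a (ltW lt_ae)) /=.
by apply: sub_all sa => e' /= /le_trans; apply; exact: ltW.
Qed.

(** In the product of two sums, the component in the sum of the two top degrees
    is the product of the two top components. *)
Lemma hom_component_top a b (s t : seq (hom_elt mu)) :
  all (fun e => hdeg e <= a) s -> all (fun e => hdeg e <= b) t ->
  hom_component (a + b) (gsum_mul s t) = hom_component a s * hom_component b t.
Proof.
move=> sa tb; rewrite component_mul [in RHS]/hom_component.
rewrite mulr_suml [RHS]big_mkcond /=.
apply: eq_big_seq => e /(allP sa) /= ea.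
case: eqVneq => [->|nea]; first by rewrite addrC addrA addNr add0r.
rewrite {1}/hom_component big1_seq ?mulr0 // => e' /andP[/eqP e'E /(allP tb) /=].
rewrite e'E leNgt => /negP []; rewrite addrAC -[ltLHS]add0r oag_ltD2rE.
by rewrite -(oag_ltD2rE (hdeg e)) add0r subrK lt_neqAle nea.
Qed.

(** If the initial term of [g] is prime with respect to products of initial
    terms, then it generates a prime ideal of the graded algebra. *)
Lemma principal_ideal_prime g gam :
  mu g = Some gam ->
  ~ ring_divides (initial_term mu g) (initial_term mu 1) ->
  (forall c d, ring_divides (initial_term mu g) (initial_term mu (c * d)) ->
     ring_divides (initial_term mu g) (initial_term mu c) \/
     ring_divides (initial_term mu g) (initial_term mu d)) ->
  is_prime_ideal (principal_ideal (initial_term mu g)).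
Proof.
move=> ggam g1 gprime; set J := principal_ideal _.
have J0 : J 0 by exists 0; rewrite mulr0.
have JD x y : J x -> J y -> J (x + y).
  by move=> [x' ->] [y' ->]; exists (x' + y'); rewrite mulrDr.
have JM x y : J y -> J (x * y).
  by move=> [y' ->]; exists (x * y'); rewrite mulrCA.
split=> //; first by rewrite -initial_term1.
have hom_prime a b c d : val_ideal mu a c -> val_ideal mu b d ->
    hom_divides mu g gam (a + b) (c * d) ->
    hom_divides mu g gam a c \/ hom_divides mu g gam b d.
  move=> ac bd gcd.
  have [/hom_divides_plus|] := boolP (inf_lt (Some a) (mu c)); first by left.
  have [/hom_divides_plus|] := boolP (inf_lt (Some b) (mu d)); first by right.
  rewrite -!inf_leNlt => db ca.
  have cE := inf_le_anti ca ac; have dE := inf_le_anti db bd.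
  have cdE : mu (c * d) = Some (a + b) by rewrite valM cE dE.
  have /gprime := (divides_hom_divides ggam cdE).2 gcd.
  rewrite (divides_hom_divides ggam cE) (divides_hom_divides ggam dE).
  exact.
have piM (s t : seq (hom_elt mu)) :
    \pi_(graded mu)%qT (gsum_mul s t) = \pi_(graded mu)%qT s * \pi_(graded mu)%qT t.
  by rewrite -gr_mulE.
suff Jst (s t : seq (hom_elt mu)) : J (\pi_(graded mu)%qT (gsum_mul s t)) ->
    J (\pi_(graded mu)%qT s) \/ J (\pi_(graded mu)%qT t).
  move=> x y; rewrite -[x]reprK -[y]reprK -piM.
  exact: Jst.
have Jhom a (u : seq (hom_elt mu)) : hom_divides mu g gam a (hom_component a u) ->
    J (\pi_(graded mu)%qT [seq e <- u | hdeg e == a]).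
  move=> gu; apply/(principal_ideal_hom_divides _ ggam) => b.
  rewrite hom_component_filter; case: eqVneq => [<-//|_].
  apply: hom_divides_plus; exact: val_ideal_plus0.
have JB x y : J (x + y) -> J x -> J y.
  move=> [z xyz] [x' ex]; exists (z - x').
  by rewrite mulrBr -xyz -ex addrC addKr.
have ltsize a (u : seq (hom_elt mu)) : has (fun e => hdeg e == a) u ->
    (size [seq e <- u | hdeg e != a] < size u)%N.
  rewrite has_count => ua.
  rewrite size_filter -(count_predC (fun e => hdeg e == a) u).
  by rewrite -[ltnLHS]add0n ltn_add2r.
(* Induction on the number of terms: the component of the product in the sum
   [a + b] of the top degrees is the product of the top components; so one of the
   two homogeneous parts of top degree lies in [J] and can be removed. *)
have [n] := ubnP (size s + size t)%N.
elim: n s t => // n IH [|e s] [|f t] stn; [by left|by left|by right|].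
have [a sa lesa] := exists_top_degree e s.
have [b tb letb] := exists_top_degree f t.
move: (e :: s) (f :: t) sa lesa tb letb stn => {e f}{}s {}t sa lesa tb letb stn Jst.
have := (principal_ideal_hom_divides _ ggam).1 Jst (a + b).
rewrite hom_component_top //.
move=> /(hom_prime _ _ _ _ (hom_component_ideal a s) (hom_component_ideal b t)) [].
  move=> /Jhom Js.
  have [||Js'|] := IH [seq e <- s | hdeg e != a] t.
  - apply: leq_trans (stn : (_ <= n)%N); by rewrite ltn_add2r ltsize.
  - move: Jst; rewrite piM (pi_split a s) mulrDl.
    by move/JB; rewrite piM; apply; rewrite mulrC; exact: JM.
  - by left; rewrite (pi_split a s); exact: JD.
  - by right.
move=> /Jhom Jt.
have [||Jt'|Jt'] := IH s [seq e <- t | hdeg e != b].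
- apply: leq_trans (stn : (_ <= n)%N); by rewrite ltn_add2l ltsize.
- move: Jst; rewrite piM (pi_split b t) mulrDr.
  by move/JB; rewrite piM; apply; exact: JM.
- by left.
- by right; rewrite (pi_split b t); exact: JD.
Qed.

End InitialTermDivisibility.

(** * Key polynomials *)

Section KeyPolynomialTheory.
Context (K : fieldType) (L : oagType) (mu : valuation {poly K} L).
Implicit Types (f g h q r phi : {poly K}) (c : K) (x y : L).

Lemma mu_dividesP g f :
  mu_divides mu g f <->
  mu f = None \/ exists q, inf_lt (mu f) (mu (f - g * q)).
Proof. exact: initial_term_dividesP. Qed.

Lemma mu_irreducibleP g :
  mu_irreducible mu g <->
  [/\ mu g <> None, ~ mu_divides mu g 1 &
      forall f h, mu_divides mu g (f * h) -> mu_divides mu g f \/ mu_divides mu g h].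
Proof.
split=> [[J0 [_ _ _ J1 Jprime]]|[g0 g1 gprime]].
  split.
  - move=> g0; apply: J0; apply/seteqP; split=> [x [y ->]|x ->] /=.
      by rewrite (initial_term_None g0) mul0r.
    by exists 0; rewrite mulr0.
  - by rewrite /mu_divides initial_term1.
  - by move=> f h; rewrite /mu_divides initial_termM; exact: Jprime.
case gE: (mu g) => [gam|]; last by rewrite gE in g0.
split; last exact: (principal_ideal_prime gE g1 gprime).
move=> J0; apply: (initial_term_neq0 gE).
suff : principal_ideal (initial_term mu g) (initial_term mu g) by rewrite J0.
by exists 1; rewrite mulr1.
Qed.

Lemma ltn_pdeg f g : f != 0 -> (pdeg f < pdeg g)%N = (size f < size g)%N.
Proof.
rewrite -size_poly_gt0 /pdeg; case: (size f) => // n _.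
by rewrite ltn_predRL.
Qed.

Lemma KP_neq0 phi : KP mu phi -> phi != 0.
Proof. by case=> /monic_neq0. Qed.

Lemma KP_fin phi : KP mu phi -> exists x, mu phi = Some x.
Proof.
by case=> _ _ /mu_irreducibleP[]; case: (mu phi) => // x; exists x.
Qed.

Lemma KP_size phi : KP mu phi -> (1 < size phi)%N.
Proof.
move=> phiP; rewrite ltnNge; apply/negP => phi1.
case: phiP => [phim _ /mu_irreducibleP[_ []]].
have -> : phi = 1.
  by move/monicP: phim; rewrite (size1_polyC phi1) lead_coefC => ->.
by exists 1; rewrite mulr1.
Qed.

Lemma mu_minimal_size phi f :
  mu_minimal mu phi -> f != 0 -> (size f < size phi)%N -> ~ mu_divides mu phi f.
Proof. by move=> phim f0 fphi; apply: phim; rewrite ?ltn_pdeg. Qed.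

(** Division with remainder by a minimal [phi] computes the valuation: no
    cancellation is possible between the initial terms of the remainder and of
    the multiple of [phi]. *)
Lemma val_divp_modp phi f :
  phi != 0 -> mu_minimal mu phi ->
  mu f = inf_min (mu (f %% phi)) (inf_add (mu (f %/ phi)) (mu phi)).
Proof.
move=> phi0 phim; set r := f %% phi; set q := f %/ phi.
have fE : f = r + q * phi by rewrite addrC -divp_eq.
rewrite -valM.
have f_le_r : inf_le (mu f) (mu r).
  have [->|r0] := eqVneq r 0; first by rewrite val0; case: (mu f).
  have := mu_minimal_size phim r0; rewrite ltn_modp => /(_ phi0).
  rewrite mu_dividesP => nr; rewrite inf_leNlt; apply/negP => lt_rf.
  by apply: nr; right; exists (- q); rewrite mulrN opprK mulrC -fE.
rewrite /inf_min; case: ifP => [le_rq|/negbT lt_qr].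
  apply: inf_le_anti => //; rewrite fE.
  by apply: val_le_add => //; exact: inf_le_refl.
by rewrite {1}fE addrC valD_lt.
Qed.

Lemma val_modp phi f :
  phi != 0 -> mu_minimal mu phi -> inf_le (mu f) (mu (f %% phi)).
Proof.
move=> phi0 phim; rewrite (val_divp_modp f phi0 phim) /inf_min.
case: ifP => [_|/negbT/inf_ltW //]; exact: inf_le_refl.
Qed.

(** The value of the remainder modulo a key polynomial is multiplicative on
    polynomials of small degree. *)
Lemma val_modpM phi f g :
  KP mu phi -> f != 0 -> (size f < size phi)%N -> g != 0 ->
  (size g < size phi)%N -> mu ((f * g) %% phi) = mu (f * g).
Proof.
move=> phiP f0 fphi g0 gphi; have phi0 := KP_neq0 phiP.
case: phiP => _ phim /mu_irreducibleP[_ _ phip].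
apply: inf_le_anti; last exact: val_modp.
rewrite inf_leNlt; apply/negP => lt_fg.
have /phip[] : mu_divides mu phi (f * g).
  apply/mu_dividesP; right; exists ((f * g) %/ phi).
  rewrite [X in X - _](divp_eq _ phi) [phi * _]mulrC.
  by rewrite [X in X - _]addrC addrK.
- exact: mu_minimal_size.
- exact: mu_minimal_size.
Qed.

(** The value group of the base field [K], as the set of the finite values of
    constant polynomials. *)
Definition base_values : set L := [set x | exists c, mu c%:P = Some x].

Lemma val_polyC_neq0 c x : mu c%:P = Some x -> c != 0.
Proof. by apply: contra_eq_neq => ->; rewrite val0. Qed.

Lemma val_polyC_fin c : c != 0 -> exists x, mu c%:P = Some x.
Proof.
move=> c0; have := val1 mu; rewrite -polyC1 -(mulfV c0) polyCM.
by move=> /val_mul_fin[x [y [-> _ _]]]; exists x.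
Qed.

Lemma base_values_subgroup : is_subgroup base_values.
Proof.
split=> [|x y [c cx] [d dy]]; first by exists 1; rewrite polyC1 val1.
have d0 := val_polyC_neq0 dy; exists (c / d).
have : mu (c / d * d)%:P = Some x by rewrite divfK.
rewrite polyCM => /val_mul_fin[x' [y' [-> dy' ->]]].
by move: dy'; rewrite dy => -[->]; rewrite addrK.
Qed.

Lemma base_values_value_group x : base_values x -> value_group mu x.
Proof. by case=> c; exact: value_group_val. Qed.

(** An element is torsion over [G] if some positive multiple lies in [G]. *)
Definition torsion_over (G : set L) : set L :=
  [set x | exists n, (0 < n)%N /\ G (x *+ n)].

Lemma ex_linear_dependence (n : nat) (F : 'I_n.+1 -> {poly K}) :
  (forall i, size (F i) <= n)%N ->
  exists u : 'I_n.+1 -> K, (exists i, u i != 0) /\ \sum_i (u i)%:P * F i = 0.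
Proof.
move=> Fn; pose M := \matrix_(i < n.+1) (poly_rV (F i) : 'rV_n).
have /rowV0Pn[v /sub_kermxP vM v0] : kermx M != 0.
  rewrite kermx_eq0 /row_free neq_ltn.
  by rewrite (leq_ltn_trans (rank_leq_col M)).
exists (fun i => v 0 i); split.
  apply: contrapT => no; case/eqP: v0; apply/rowP => i; rewrite mxE.
  by apply/eqP/negPn/negP => vi; apply: no; exists i.
have := congr1 (@rVpoly _ _) vM; rewrite mulmx_sum_row !linear_sum linear0.
move=> sum0; apply: etrans sum0; apply: eq_bigr => i _.
by rewrite linearZ /= rowK poly_rV_K // mul_polyC.
Qed.

(** The values of the polynomials of degree smaller than [deg phi] are the
    values of a valuation on the finite extension [K[x]/(phi)] of [K], hence
    they are torsion over the value group of [K]. *)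
Lemma small_val_torsion phi f x :
  KP mu phi -> (size f < size phi)%N -> mu f = Some x ->
  torsion_over base_values x.
Proof.
move=> phiP fphi fx; have phi0 := KP_neq0 phiP; have phi1 := KP_size phiP.
have phim : mu_minimal mu phi by case: phiP.
have f0 : f != 0 by apply/eqP => f0; move: fx; rewrite f0 val0.
(* The powers [f ^ i] modulo [phi], for [i <= deg phi], are linearly dependent,
   so two terms [u_i f ^ i] and [u_j f ^ j] have the same value. *)
pose pw i := iter i (fun g => (f * g) %% phi) 1.
have pw_size i : (size (pw i) < size phi)%N.
  by case: i => [|i]; rewrite /pw /= ?size_poly1 // ltn_modp.
have pwE i : mu (pw i) = Some (x *+ i).
  elim: i => [|i IH]; first by rewrite mulr0n val1.
  have pwi0 : pw i != 0 by apply/eqP => e; move: IH; rewrite e val0.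
  by rewrite [pw _]/= (val_modpM phiP f0 fphi pwi0 (pw_size i)) valM fx IH /= mulrS.
pose n := (size phi).-1.
have [|u [[i0 ui0] u0]] := @ex_linear_dependence n (fun i => pw i).
  by move=> i; have := pw_size i; rewrite -[ltnRHS](prednK (ltnW phi1)).
have [|i [j [ltij ij ifin]]] := @val_sum0 _ _ mu _ _ i0 u0.
  by have [y uy] := val_polyC_fin ui0; rewrite valM uy pwE.
move: ij ifin; rewrite !valM !pwE.
case iE : (mu (u i)%:P) => [y|//]; case jE : (mu (u j)%:P) => [z|//] [yz] _.
exists (j - i)%N; split; first by rewrite subn_gt0.
have -> : x *+ (j - i) = y - z.
  rewrite mulrnBr 1?ltnW //; apply: (addrI z); rewrite addrA -yz addrK.
  by rewrite addrCA subrr addr0.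
by apply: base_values_subgroup.2; [exists (u i)|exists (u j)].
Qed.

(** All key polynomials of minimal degree have the same value: if
    [mu phi < mu psi], then [phi] and [phi - psi] have the same initial term,
    although [phi - psi] has smaller degree. *)
Lemma min_KP_val phi psi : min_KP mu phi -> min_KP mu psi -> mu phi = mu psi.
Proof.
wlog lt_val : phi psi / inf_lt (mu phi) (mu psi).
  move=> H phiP psiP; apply: contrapT => ne; apply: ne.
  apply: inf_le_anti; rewrite inf_leNlt; apply/negP => lt.
    by have := H _ _ lt psiP phiP => e; rewrite e (negbTE (inf_lt_irr _)) in lt.
  by have := H _ _ lt phiP psiP => e; rewrite e (negbTE (inf_lt_irr _)) in lt.
move=> [phiP phile] [psiP psile]; exfalso.
have phi_mon : phi \is monic by case: phiP.
have psi_mon : psi \is monic by case: psiP.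
have size_eq : size phi = size psi.
  have := phile _ psiP; have := psile _ phiP; rewrite /pdeg => h1 h2.
  have : (size phi).-1 = (size psi).-1 by apply/eqP; rewrite eqn_leq h1 h2.
  move=> e; rewrite -(prednK (ltnW (KP_size phiP))) -(prednK (ltnW (KP_size psiP))).
  by rewrite e.
have diff_val : mu (phi - psi) = mu phi by rewrite valD_lt // val_opp.
have [x phix] := KP_fin phiP.
have diff0 : phi - psi != 0.
  by apply/eqP => e; move: diff_val; rewrite e val0 phix.
have diff_size : (size (phi - psi)%R < size phi)%N.
  rewrite -[ltnRHS](prednK (ltnW (KP_size phiP))) ltnS; apply/leq_sizeP => i.
  rewrite leq_eqVlt coefB => /orP[/eqP <-|lt_i].
    move: phi_mon psi_mon; rewrite !monicE /lead_coef -size_eq.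
    by move=> /eqP -> /eqP ->; rewrite subrr.
  have phii : (size phi <= i)%N by rewrite -[leqLHS](prednK (ltnW (KP_size phiP))).
  by rewrite !nth_default ?subrr // -size_eq.
have phim : mu_minimal mu phi by case: phiP.
apply: (mu_minimal_size phim diff0 diff_size).
apply/mu_dividesP; right; exists 1.
by rewrite mulr1 diff_val addrC addKr val_opp.
Qed.

Lemma some_min_KPP phi : min_KP mu phi -> min_KP mu (some_min_KP mu).
Proof. by move=> phiP; rewrite /some_min_KP; case: xgetP => // /(_ phi). Qed.

Lemma node_degE phi : min_KP mu phi -> node_deg mu = pdeg phi.
Proof.
move=> phiP; have [psiP psile] := some_min_KPP phiP; case: phiP => phiP phile.
by apply/eqP; rewrite eqn_leq phile ?psile.
Qed.

Lemma svE phi x : min_KP mu phi -> mu phi = Some x -> sv mu = x.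
Proof.
by move=> phiP phix; rewrite /sv (min_KP_val (some_min_KPP phiP) phiP) phix.
Qed.

Lemma ex_min_KP phi : KP mu phi -> exists psi, min_KP mu psi.
Proof.
move=> phiP.
have [n] := ubnP (pdeg phi); elim: n phi phiP => // n IH phi phiP phin.
have [[psi [psiP lt_psi]]|no] :=
  pselect (exists psi, KP mu psi /\ (pdeg psi < pdeg phi)%N).
  exact: IH psiP (leq_trans lt_psi phin).
exists phi; split=> // psi psiP; rewrite leqNgt; apply/negP => lt_psi.
by apply: no; exists psi.
Qed.

End KeyPolynomialTheory.

(** Key polynomials only depend on the comparison of values. *)
Lemma KP_sub (K : fieldType) (L L' : oagType) (mu : valuation {poly K} L)
    (nu : valuation {poly K} L') :
  (forall f g, inf_le (mu f) (mu g) = inf_le (nu f) (nu g)) ->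
  KP mu `<=` KP nu.
Proof.
move=> munu; have lt_munu f g : inf_lt (mu f) (mu g) = inf_lt (nu f) (nu g).
  by rewrite /inf_lt munu.
have None_munu f : mu f = None <-> nu f = None.
  have := munu 0 f; rewrite !val0.
  by case: (mu f) (nu f) => [x|] [y|].
have div_munu g f : mu_divides mu g f <-> mu_divides nu g f.
  rewrite !mu_dividesP None_munu; split=> -[|[q fq]]; try (by left).
    by right; exists q; rewrite -lt_munu.
  by right; exists q; rewrite lt_munu.
move=> phi [phim phimin /mu_irreducibleP[phi0 phi1 phip]]; split=> //.
  by move=> f f0 lt_f; rewrite -div_munu; exact: phimin.
apply/mu_irreducibleP; split; rewrite -?None_munu -?div_munu // => f g.
by rewrite -!div_munu; exact: phip.
Qed.

(** * Inner nodes have key polynomials *)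

Section InnerNodes.
Context (K : fieldType) (L : oagType) (mu rho : valuation {poly K} L).
Implicit Types (f g h q r phi : {poly K}) (c : K).

Lemma ex_min_size (P : {poly K} -> Prop) f :
  P f -> exists2 g, P g & forall h, P h -> (size g <= size h)%N.
Proof.
move=> Pf; have [n] := ubnP (size f); elim: n f Pf => // n IH f Pf fn.
have [[g [Pg lt_gf]]|no] := pselect (exists g, P g /\ (size g < size f)%N).
  exact: IH Pg (leq_trans lt_gf fn).
exists f => // g Pg; rewrite leqNgt; apply/negP => lt_gf.
by apply: no; exists g.
Qed.

Hypothesis mu_le_rho : val_le mu rho.

(** A valuation with nonzero support is maximal: the support is a maximal ideal,
    and an inverse of [g] modulo the support bounds the value of [g]. *)
Lemma val_le_support f : f != 0 -> mu f = None -> mu = rho.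
Proof.
move=> f0 finf.
have [|p [p0 pinf] pmin] := @ex_min_size (fun g => g != 0 /\ mu g = None) f.
  by [].
have rho_inf g : mu g = None -> rho g = None.
  by move=> ginf; have := mu_le_rho g; rewrite ginf; case: (rho g).
apply: valuation_ext => g; case gE: (mu g) => [x|]; last by rewrite rho_inf.
have /Bezout_eq1_coprimepP[[u v] /= uv] : coprimep g p.
  set e := gcdp g p; have e0 : e != 0 by rewrite gcdp_eq0 (negPf p0) andbF.
  have pE : p = p %/ e * e by rewrite divpK ?dvdp_gcdr.
  have efin : mu e <> None.
    move=> einf; have := gE; rewrite -[g](@divpK _ e) ?dvdp_gcdl //.
    by rewrite valM einf; case: (mu _).
  have qinf : mu (p %/ e) = None.
    have := pinf; rewrite pE valM -pE.
    by case: (mu (p %/ e)) (mu e) efin => [y|] [z|].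
  have q0 : p %/ e != 0 by apply: contraNneq p0 => q0; rewrite pE q0 mul0r.
  have := pmin _ (conj q0 qinf); rewrite size_divp //.
  have : (0 < size e)%N by rewrite size_poly_gt0.
  have : (0 < size p)%N by rewrite size_poly_gt0.
  rewrite coprimep_def -/e; case: (size e) (size p) => [|[|m]] [|n] // _ _.
  by rewrite leqNgt ltn_subrL.
have val_ug (nu : valuation {poly K} L) : nu p = None -> nu (u * g) = Some 0.
  move=> nup; rewrite -(valD_inf (u * g) (_ : nu (v * p) = None)) ?uv ?val1 //.
  by rewrite valM nup; case: (nu v).
have := val_ug _ (rho_inf _ pinf); have := val_ug _ pinf.
have := mu_le_rho u; have := mu_le_rho g; rewrite !valM gE.
case: (rho g) (mu u) (rho u) => [y|] [z|] [t|] //= xy zt [zx] [ty].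
congr Some; apply/le_anti; rewrite xy /=.
by rewrite -(oag_leD2lE t) ty -zx oag_leD2r.
Qed.

Lemma val_lt_mul f q :
  inf_lt (mu f) (rho f) -> mu q <> None -> inf_lt (mu (f * q)) (rho (f * q)).
Proof.
rewrite !valM; case qE: (mu q) => [z|//] lt_f _.
apply: inf_lt_le_trans (inf_ltD2r z lt_f) _.
by rewrite -qE ![inf_add (rho f) _]inf_addC; apply: inf_leD2r; exact: mu_le_rho.
Qed.

(** If [mu < rho], a monic polynomial [phi] of minimal degree among those with
    [mu phi < rho phi] is a key polynomial for [mu]: its initial term divides
    that of [f] exactly when [mu f < rho f]. *)
Lemma val_lt_KP :
  (forall c, mu c%:P = rho c%:P) -> mu <> rho -> exists phi, KP mu phi.
Proof.
move=> const_eq mu_neq.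
have fin f : f != 0 -> mu f <> None by move=> f0 /(val_le_support f0).
have [f0 lt_f0] : exists f, inf_lt (mu f) (rho f).
  apply: contrapT => no; apply: mu_neq; apply: valuation_ext => f.
  apply: inf_le_anti => //; rewrite inf_leNlt; apply/negP => lt_f.
  by apply: no; exists f.
have [psi lt_psi psi_min] := @ex_min_size (fun f => inf_lt (mu f) (rho f)) f0 lt_f0.
have psi0 : psi != 0 by apply: contraTneq lt_psi => ->; rewrite !val0.
pose c := (lead_coef psi)^-1.
have c0 : c != 0 by rewrite invr_eq0 lead_coef_eq0.
pose phi := psi * c%:P.
have lt_phi : inf_lt (mu phi) (rho phi).
  by apply: val_lt_mul => //; apply: fin; rewrite polyC_eq0.
have phi_mon : phi \is monic.
  by rewrite monicE lead_coefM lead_coefC mulfV ?lead_coef_eq0.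
have phi0 := monic_neq0 phi_mon.
have phi_min f : inf_lt (mu f) (rho f) -> (size phi <= size f)%N.
  by move/psi_min; rewrite /phi mulrC size_Cmul.
have divP f : f != 0 -> mu_divides mu phi f <-> inf_lt (mu f) (rho f).
  move=> /fin ffin; rewrite mu_dividesP; split=> [[//|[q lt_q]]|lt_f].
    have phiqE : mu (phi * q) = mu f.
      by rewrite -[phi * q](subKr f) valD_lt // val_opp.
    rewrite -[X in rho X](subrK (phi * q)); apply: val_lt_add.
      exact: inf_lt_le_trans lt_q (mu_le_rho _).
    rewrite -phiqE; apply: val_lt_mul => // qinf.
    by apply: ffin; rewrite -phiqE valM qinf; case: (mu phi).
  right; exists (f %/ phi); set q := f %/ phi; set r := f %% phi.
  have fE : f = r + phi * q by rewrite addrC mulrC -divp_eq.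
  rewrite {2}fE addrK.
  have r_eq : mu r = rho r.
    apply: inf_le_anti; first exact: mu_le_rho.
    rewrite inf_leNlt; apply/negP => /phi_min.
    by rewrite leqNgt ltn_modp phi0.
  rewrite /inf_lt; apply/negP => le_rf.
  have rho_phiq : rho (phi * q) = mu r.
    have -> : phi * q = - r + f by rewrite fE addKr.
    rewrite valD_lt ?val_opp -?r_eq //.
    exact: inf_le_lt_trans le_rf lt_f.
  have : inf_lt (mu (phi * q)) (rho (phi * q)).
    apply: val_lt_mul => // qinf; apply: ffin.
    have : rho (phi * q) = None.
      rewrite valM; have := mu_le_rho q; rewrite qinf.
      by case: (rho q) => // _; case: (rho phi).
    by rewrite rho_phiq => rinf; move: le_rf; rewrite rinf; case: (mu f).
  rewrite rho_phiq; apply/negP; rewrite -inf_leNlt.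
  have -> : phi * q = - r + f by rewrite fE addKr.
  by apply: val_le_add; rewrite ?val_opp ?inf_le_refl.
exists phi; split=> //.
  move=> f f_neq0; rewrite ltn_pdeg // divP // => lt_size /phi_min.
  by rewrite leqNgt lt_size.
apply/mu_irreducibleP; split.
- exact: fin.
- by rewrite divP ?oner_eq0 // !val1 (negbTE (inf_lt_irr _)).
move=> f g; have [->|f_neq0] := eqVneq f 0.
  by left; apply/mu_dividesP; left; rewrite val0.
have [->|g_neq0] := eqVneq g 0.
  by right; apply/mu_dividesP; left; rewrite val0.
rewrite !divP ?mulf_neq0 // => lt_fg.
have [|le_f] := boolP (inf_lt (mu f) (rho f)); first by left.
have [|le_g] := boolP (inf_lt (mu g) (rho g)); first by right.
move: lt_fg; rewrite !valM.
have -> : mu f = rho f by apply: inf_le_anti; [exact: mu_le_rho|rewrite inf_leNlt].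
have -> : mu g = rho g by apply: inf_le_anti; [exact: mu_le_rho|rewrite inf_leNlt].
by rewrite (negbTE (inf_lt_irr _)).
Qed.

End InnerNodes.

Lemma inner_min_KP (K : fieldType) (L : oagType) (w : K -> option L)
    (mu : valuation {poly K} L) :
  is_inner w mu -> exists phi, min_KP mu phi.
Proof.
move=> [muT no_leaf].
suff [rho [rhoT mu_rho rho_neq]] :
    exists rho, [/\ tree w rho, val_le mu rho & rho <> mu].
  have [||phi /ex_min_KP //] := val_lt_KP mu_rho; last exact/nesym.
  by move=> c; rewrite muT rhoT.
apply: contrapT => no; apply: no_leaf; split=> // rho rhoT mu_rho.
by apply: contrapT => rho_neq; apply: no; exists rho.
Qed.

(** * Isomorphisms between subgroups *)

Section Subgroups.
Context (G : oagType).
Implicit Types (X D : set G).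

Lemma is_subgroupD D x y : is_subgroup D -> D x -> D y -> D (x + y).
Proof.
move=> [D0 DB] Dx Dy; rewrite -[y]opprK; apply: (DB _ _ Dx).
by rewrite -sub0r; apply: DB.
Qed.

Lemma is_subgroup_mulrn D x n : is_subgroup D -> D x -> D (x *+ n).
Proof.
move=> Dsub Dx; elim: n => [|n IH]; first by rewrite mulr0n; exact: Dsub.1.
by rewrite mulrS; exact: is_subgroupD.
Qed.

Lemma is_subgroup_mulrz D x (n : int) : is_subgroup D -> D x -> D (x *~ n).
Proof.
move=> Dsub Dx; case: n => n; first exact: is_subgroup_mulrn.
rewrite NegzE mulrNz -sub0r; apply: Dsub.2; first exact: Dsub.1.
exact: is_subgroup_mulrn.
Qed.

Lemma subgroup_gen_subgroup X : is_subgroup (subgroup_gen X).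
Proof.
split=> [D [[D0 _] _] //|x y Gx Gy D DP].
by apply: DP.1.2; [exact: Gx|exact: Gy].
Qed.

Lemma subgroup_gen_sub X D : is_subgroup D -> X `<=` D -> subgroup_gen X `<=` D.
Proof. by move=> Dsub XD x; apply. Qed.

End Subgroups.

Section AdditiveOn.
Context (G G' : oagType).
Variables (D : set G) (f : G -> G').
Hypothesis Dsub : is_subgroup D.
Hypothesis fD : forall x y, D x -> D y -> f (x + y) = f x + f y.

Lemma additive_on0 : f 0 = 0.
Proof.
have := fD Dsub.1 Dsub.1; rewrite addr0 => /(congr1 (fun z => z - f 0)).
by rewrite subrr addrK.
Qed.

Lemma additive_onB x y : D x -> D y -> f (x - y) = f x - f y.
Proof.
move=> Dx Dy; have := fD (Dsub.2 _ _ Dx Dy) Dy.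
by rewrite subrK => ->; rewrite addrK.
Qed.

Lemma additive_on_mulrn x n : D x -> f (x *+ n) = f x *+ n.
Proof.
move=> Dx; elim: n => [|n IH]; first by rewrite !mulr0n additive_on0.
by rewrite !mulrS fD ?IH //; exact: is_subgroup_mulrn.
Qed.

Lemma additive_on_mulrz x (n : int) : D x -> f (x *~ n) = f x *~ n.
Proof.
move=> Dx; case: n => n; first exact: additive_on_mulrn.
rewrite NegzE !mulrNz -[LHS]/(f (- (x *+ n.+1))) -[in LHS]sub0r additive_onB.
- by rewrite additive_on0 sub0r additive_on_mulrn.
- exact: Dsub.1.
- exact: is_subgroup_mulrn.
Qed.

Lemma image_subgroup_gen (X : set G) : X `<=` D ->
  f @` subgroup_gen X = subgroup_gen (f @` X).
Proof.
move=> XD; have genD : subgroup_gen X `<=` D by exact: subgroup_gen_sub.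
have [gen0 genB] := subgroup_gen_subgroup X.
have [img0 imgB] := subgroup_gen_subgroup (f @` X).
apply/seteqP; split=> [_ [x Xx <-]|].
  suff /(_ x Xx)[] : subgroup_gen X `<=`
      [set x | D x /\ subgroup_gen (f @` X) (f x)] by [].
  apply: subgroup_gen_sub.
    split=> [|y z [Dy fy] [Dz fz]].
      by split; [exact: Dsub.1|rewrite additive_on0; exact: img0].
    split; first exact: Dsub.2.
    by rewrite additive_onB //; exact: imgB.
  move=> y Xy; split; first exact: XD.
  by apply: sub_gen_smallest; exists y.
apply: subgroup_gen_sub.
  split=> [|_ _ [x Xx <-] [y Xy <-]].
    by exists 0; [exact: gen0|exact: additive_on0].
  by exists (x - y); [exact: genB|rewrite additive_onB //; exact: genD].
by move=> _ [x Xx <-]; exists x => //; exact: sub_gen_smallest.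
Qed.

End AdditiveOn.

(** * Equivalence of valuations *)

Lemma val_equiv_le (A : comPzRingType) (L L' : oagType) (mu : valuation A L)
    (nu : valuation A L') :
  val_equiv mu nu -> forall f g, inf_le (mu f) (mu g) = inf_le (nu f) (nu g).
Proof.
move=> [F [[_ _ Fle] nuE]] f g; rewrite !nuE.
case fE: (mu f) => [x|]; case gE: (mu g) => [y|] //=.
by rewrite Fle //; [exact: value_group_val fE|exact: value_group_val gE].
Qed.

Lemma val_equiv_KP (K : fieldType) (L L' : oagType) (mu : valuation {poly K} L)
    (nu : valuation {poly K} L') :
  val_equiv mu nu -> KP mu = KP nu.
Proof.
move=> /val_equiv_le munu; apply/seteqP.
by split; apply: KP_sub => f g; rewrite munu.
Qed.

Section Equivalence.
Context (K : fieldType) (L : oagType) (mu nu : valuation {poly K} L).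
Implicit Types (f g phi : {poly K}) (x y a : L) (m n : int).
Hypothesis const_eq : forall c : K, mu c%:P = nu c%:P.

Local Notation Gam := (base_values mu).

Lemma fixed_torsion (D : set L) (F : L -> L) x :
  is_subgroup D -> (forall x y, D x -> D y -> F (x + y) = F x + F y) ->
  (forall x, Gam x -> F x = x) -> D x -> torsion_over Gam x -> F x = x.
Proof.
move=> Dsub FD FG Dx [n [n0 Gx]]; apply: (oag_mulrn_inj n0).
by rewrite -(additive_on_mulrn Dsub) // FG.
Qed.

(** An equivalence is the identity on the values of constants, hence on their
    torsion hull, which contains the values in degree smaller than [deg phi]. *)
Lemma val_equiv_conditions phi b b' :
  KP mu phi -> val_equiv mu nu -> mu phi = Some b -> nu phi = Some b' ->
  (forall f, (size f < size phi)%N -> mu f = nu f) /\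
  exists F : L -> L,
    [/\ is_oag_iso (subgroup_gen (Gam `|` [set b]))
                   (subgroup_gen (Gam `|` [set b'])) F,
        forall x, Gam x -> F x = x & F b = b'].
Proof.
move=> phiP [F [[Fimg FD Fle] nuE]] phib phib'.
have vsub := value_group_subgroup mu.
have FG x : Gam x -> F x = x.
  by move=> [c cx]; have := nuE c%:P; rewrite -const_eq cx /= => -[].
have Fb : F b = b' by move: phib'; rewrite nuE phib /= => -[].
split.
  move=> f fphi; rewrite nuE; case fE: (mu f) => [x|//] /=; congr Some.
  symmetry; apply: (fixed_torsion vsub) => //; first exact: value_group_val fE.
  exact: small_val_torsion phiP fphi fE.
have sub : Gam `|` [set b] `<=` value_group mu.
  move=> x [/base_values_value_group //|->]; exact: value_group_val phib.
have gsub : subgroup_gen (Gam `|` [set b]) `<=` value_group mu.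
  exact: subgroup_gen_sub.
exists F; split=> //; split; last 2 first.
- by move=> x y /gsub Gx /gsub Gy; exact: FD.
- by move=> x y /gsub Gx /gsub Gy; exact: Fle.
rewrite (image_subgroup_gen vsub) //; congr (subgroup_gen _).
apply/seteqP; split=> [_ [x [Gx|->] <-]|x [Gx|->]].
- by left; rewrite FG.
- by right; rewrite /= Fb.
- by exists x; [left|exact: FG].
- by exists b; [right|exact: Fb].
Qed.

(** Conversely, agreement in degree smaller than [deg phi] together with an
    isomorphism [F] over the values of constants which maps [mu phi = b] to
    [nu phi = b'] gives an equivalence. *)

Section Converse.
Variables (phi : {poly K}) (b b' : L) (F : L -> L).
Hypothesis mu_phi : KP mu phi.
Hypothesis nu_phi : KP nu phi.
Hypothesis small_eq : forall f, (size f < size phi)%N -> mu f = nu f.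
Hypothesis phib : mu phi = Some b.
Hypothesis phib' : nu phi = Some b'.
Hypothesis Fiso : is_oag_iso (subgroup_gen (Gam `|` [set b]))
                             (subgroup_gen (Gam `|` [set b'])) F.
Hypothesis FG : forall x, Gam x -> F x = x.
Hypothesis Fb : F b = b'.

Lemma torsion_over_subgroup : is_subgroup (torsion_over Gam).
Proof.
have Gsub := base_values_subgroup mu.
split=> [|x y [n [n0 Gx]] [m [m0 Gy]]].
  by exists 1%N; split=> //; exact: Gsub.1.
exists (n * m)%N; split; first by rewrite muln_gt0 n0.
rewrite mulrnBl [in X in _ - X]mulnC !mulrnA.
by apply: Gsub.2; exact: is_subgroup_mulrn.
Qed.

(** The sign of [a + n b] is that of a multiple lying in the domain of the
    isomorphism [F], which maps it to the same multiple of [a + n b']. *)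
Lemma torsion_ge0 a n : torsion_over Gam a ->
  (0 <= a + b *~ n) = (0 <= a + b' *~ n).
Proof.
move=> [m [m0 Ga]]; rewrite -(oag_mulrn_ge0 (_ + b *~ _) m0).
rewrite -(oag_mulrn_ge0 (_ + b' *~ _) m0) !mulrnDl.
have [_ FD Fle] := Fiso; set D := subgroup_gen _ in FD Fle.
have Dsub : is_subgroup D by exact: subgroup_gen_subgroup.
have Db : D b by apply: sub_gen_smallest; right.
have DG x : Gam x -> D x by move=> Gx; apply: sub_gen_smallest; left.
have Dbn : D (b *~ n *+ m).
  exact: (is_subgroup_mulrn _ Dsub (is_subgroup_mulrz _ Dsub Db)).
have FDa : F (a *+ m + b *~ n *+ m) = a *+ m + b' *~ n *+ m.
  rewrite FD //; last exact: DG.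
  rewrite FG // (additive_on_mulrn Dsub) ?(additive_on_mulrz Dsub) ?Fb //.
  exact: (is_subgroup_mulrz _ Dsub Db).
rewrite -[in RHS](additive_on0 Dsub FD) -FDa Fle //; first exact: Dsub.1.
exact: (is_subgroupD Dsub (DG _ Ga) Dbn).
Qed.

(** The subgroup of the elements [a + n b] with [a] torsion over the values of
    constants; it contains the value group of [mu]. *)
Definition torsion_span : set L :=
  [set x | exists a n, torsion_over Gam a /\ x = a + b *~ n].

(** The map [a + n b |-> a + n b'] on the torsion span; its value [0] elsewhere
    plays no role. *)
Definition span_map x : L :=
  xget 0 [set y | exists a n,
    [/\ torsion_over Gam a, x = a + b *~ n & y = a + b' *~ n]].

Lemma span_le a n a' n' : torsion_over Gam a -> torsion_over Gam a' ->
  (a + b *~ n <= a' + b *~ n') = (a + b' *~ n <= a' + b' *~ n').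
Proof.
move=> ta ta'; rewrite -[LHS]oag_subr_ge0 -[RHS]oag_subr_ge0.
have diffE c : a' + c *~ n' - (a + c *~ n) = (a' - a) + c *~ (n' - n).
  by rewrite opprD addrACA -mulrzBr.
rewrite !diffE; apply: torsion_ge0; exact: torsion_over_subgroup.2.
Qed.

Lemma span_mapE a n : torsion_over Gam a -> span_map (a + b *~ n) = a + b' *~ n.
Proof.
move=> ta; rewrite /span_map; case: xgetP => [y _ [a' [n' [ta' e ->]]]|no].
  apply/le_anti; rewrite -!span_le // -e lexx //.
by case: (no (a + b' *~ n)); exists a, n.
Qed.

Lemma torsion_span_subgroup : is_subgroup torsion_span.
Proof.
split=> [|_ _ [a [n [ta ->]]] [a' [n' [ta' ->]]]].
  exists 0, 0; split; first exact: torsion_over_subgroup.1.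
  by rewrite mulr0z addr0.
exists (a - a'), (n - n'); split; first exact: torsion_over_subgroup.2.
by rewrite opprD addrACA -mulrzBr.
Qed.

Lemma span_mapD x y : torsion_span x -> torsion_span y ->
  span_map (x + y) = span_map x + span_map y.
Proof.
move=> [a [n [ta ->]]] [a' [n' [ta' ->]]].
rewrite addrACA -mulrzDr !span_mapE //; first by rewrite mulrzDr addrACA.
exact: (is_subgroupD torsion_over_subgroup).
Qed.

Lemma span_map_le x y : torsion_span x -> torsion_span y ->
  (span_map x <= span_map y) = (x <= y).
Proof.
by move=> [a [n [ta ->]]] [a' [n' [ta' ->]]]; rewrite !span_mapE // span_le.
Qed.

Lemma torsion_in_span a : torsion_over Gam a -> torsion_span a.
Proof. by exists a, 0; rewrite mulr0z addr0. Qed.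

Lemma span_map_torsion a : torsion_over Gam a -> span_map a = a.
Proof. by move=> /(@span_mapE a 0); rewrite !mulr0z !addr0. Qed.

Lemma b_in_span : torsion_span b.
Proof.
exists 0, 1; split; first exact: torsion_over_subgroup.1.
by rewrite mulr1z add0r.
Qed.

Lemma span_map_b : span_map b = b'.
Proof.
have := @span_mapE 0 1 torsion_over_subgroup.1.
by rewrite !mulr1z !add0r.
Qed.

(** The map sends [mu f] to [nu f], by induction on the degree of [f] through
    division by [phi]. *)
Lemma val_span_map f :
  (forall x, mu f = Some x -> torsion_span x) /\ nu f = omap span_map (mu f).
Proof.
have phi0 := KP_neq0 mu_phi; have phi1 := KP_size mu_phi.
have small g : (size g < size phi)%N ->
    (forall x, mu g = Some x -> torsion_span x) /\ nu g = omap span_map (mu g).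
  move=> gphi; rewrite -(small_eq gphi).
  have tg x (gx : mu g = Some x) := small_val_torsion mu_phi gphi gx.
  split=> [x /tg /torsion_in_span //|].
  by case gE: (mu g) => [x|//] /=; rewrite span_map_torsion //; exact: tg.
have [n] := ubnP (size f); elim: n f => // n IH f fn.
have [/small //|le_phi] := ltnP (size f) (size phi).
have [rspan rE] : (forall x, mu (f %% phi) = Some x -> torsion_span x) /\
    nu (f %% phi) = omap span_map (mu (f %% phi)).
  by apply: small; rewrite ltn_modp.
have [qspan qE] : (forall x, mu (f %/ phi) = Some x -> torsion_span x) /\
    nu (f %/ phi) = omap span_map (mu (f %/ phi)).
  apply: IH; rewrite size_divp //; apply: leq_trans (fn : (_ <= n)%N).
  rewrite ltn_subrL -ltnS prednK ?(ltnW phi1) // phi1.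
  by rewrite (leq_trans _ le_phi) // ltnW.
have muE := val_divp_modp f phi0 (let: And3 _ m _ := mu_phi in m).
have nuE := val_divp_modp f phi0 (let: And3 _ m _ := nu_phi in m).
rewrite muE nuE rE qE phib phib'.
case: (mu (f %% phi)) rspan => [r|] rspan;
  case: (mu (f %/ phi)) qspan => [q|] qspan //=.
- have rP := rspan _ erefl; have qP := qspan _ erefl.
  have qbP := is_subgroupD torsion_span_subgroup qP b_in_span.
  rewrite -span_map_b -span_mapD //; last exact: b_in_span.
  rewrite /inf_min /= span_map_le //.
  by case: ifP => _; split=> // x [<-].
- rewrite /inf_min /=; have qP := qspan _ erefl.
  have qbP := is_subgroupD torsion_span_subgroup qP b_in_span.
  rewrite -span_map_b -span_mapD //; last exact: b_in_span.
  by split=> // x [<-].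
Qed.

Lemma span_map_equiv : val_equiv mu nu.
Proof.
have vals : [set x | exists f, mu f = Some x] `<=` torsion_span.
  by move=> x [f fx]; exact: (val_span_map f).1.
have gvals : value_group mu `<=` torsion_span.
  exact: subgroup_gen_sub torsion_span_subgroup vals.
exists span_map; split; last by move=> f; exact: (val_span_map f).2.
split.
- rewrite /value_group (image_subgroup_gen torsion_span_subgroup span_mapD vals).
  congr (subgroup_gen _); apply/seteqP; split=> [_ [x [f fx] <-]|x [f fx]].
    by exists f; rewrite (val_span_map f).2 fx.
  move: fx; rewrite (val_span_map f).2; case fE: (mu f) => [y|//] [<-].
  by exists y => //; exists f.
- by move=> x y /gvals Gx /gvals Gy; exact: span_mapD.
- by move=> x y /gvals Gx /gvals Gy; exact: span_map_le.
Qed.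

End Converse.
End Equivalence.

(** * Comparison of equivalent inner nodes *)

Theorem proposition6p3
    (K : fieldType) (Gam : oagType) (v : valuation K Gam)
    (v_onto : forall g : Gam, exists a : K, a != 0 /\ v a = Some g)
    (GQ : oagType) (j : {additive Gam -> GQ}) (j_hull : is_rational_hull j)
    (d : Order.disp_t) (I : orderType d) (H : I -> set GQ)
    (H_index : indexes_principal H)
    (Q : I -> oagType) (p : forall i, GQ -> Q i)
    (Q_quot : forall i, is_quotient_map (H i) (convex_star (H i)) (p i))
    (h : {additive GQ -> hahn Q}) (h_mono : {mono h : x y / x <= y})
    (h_skel : @induces_skeleton_iso GQ (hahn_oag Q) h)
    (R : realType) (t : forall i, {additive Q i -> R})
    (t_mono : forall i, {mono t i : x y / x <= y})
    (t_one : forall i, exists2 q : Q i, 0 < q & t i q = 1) :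
  let emb : Gam -> big_hahn R I := base_embedding j h t in
  let w : K -> option (big_hahn R I) := fun a => omap emb (v a) in
  forall mu nu : valuation {poly K} (big_hahn R I),
    tree0 w mu -> is_inner w mu -> tree0 w nu -> is_inner w nu ->
    (val_equiv mu nu <->
      [/\ exists phi, min_KP mu phi /\ min_KP nu phi,
          forall a : {poly K}, (pdeg a < node_deg mu)%N -> mu a = nu a
        & sim_sme (range emb) (sv mu) (sv nu)]) /\
    (val_equiv mu nu -> KP mu = KP nu).
Proof.
move=> emb w mu nu [muT [S muS]] mu_inner [nuT [S' nuS]] _.
have const_eq c : mu c%:P = nu c%:P by rewrite muT nuT.
(* As [v] is onto, the embedded copy of [Gam] is the set of values of constants. *)
have rangeE : range emb = base_values mu.
  apply/seteqP; split=> [_ [g _ <-]|x [c]].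
    by have [a [_ va]] := v_onto g; exists a; rewrite muT /w va.
  by rewrite muT /w; case: (v c) => [g|//] [<-]; exists g.
split; last exact: val_equiv_KP.
rewrite rangeE.
split=> [equiv|[[phi [mu_phi nu_phi]] small_eq [_ _ [F [Fiso FG Fsv]]]]].
  have [phi mu_phi] := inner_min_KP mu_inner.
  have nu_phi : min_KP nu phi by rewrite /min_KP -(val_equiv_KP equiv).
  have [b phib] := KP_fin mu_phi.1; have [b' phib'] := KP_fin nu_phi.1.
  have [small_eq [F [Fiso FG Fb]]] :=
    val_equiv_conditions const_eq mu_phi.1 equiv phib phib'.
  split; first by exists phi.
    move=> a; rewrite (node_degE mu_phi).
    have [->|a0] := eqVneq a 0; first by rewrite !val0.
    by rewrite ltn_pdeg //; exact: small_eq.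
  rewrite (svE mu_phi phib) (svE nu_phi phib'); split; last by exists F.
  - by exists S => //; apply: muS; exact: value_group_val phib.
  - by exists S' => //; apply: nuS; exact: value_group_val phib'.
have [b phib] := KP_fin mu_phi.1; have [b' phib'] := KP_fin nu_phi.1.
move: Fiso Fsv; rewrite (svE mu_phi phib) (svE nu_phi phib') => Fiso Fb.
apply: (span_map_equiv mu_phi.1 nu_phi.1 _ phib phib' Fiso FG Fb) => a lt_a.
have [->|a0] := eqVneq a 0; first by rewrite !val0.
by apply: small_eq; rewrite (node_degE mu_phi) ltn_pdeg.
Qed.
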